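(* Let $\mathbb{K}\in\{\mathbb{R},\mathbb{C},\mathbb{H},\mathbb{O}\}$ and $\mathbb{K}'\in\{\mathbb{R}',\mathbb{C}',\mathbb{H}',\mathbb{O}'\}$. The second-order homogeneous elements $\mathbf{P}_1\cdot\mathbf{P}_2$ of $\mathrm{C}\ell(\kappa+\kappa'_+,\kappa'_-)=\mathrm{C}\ell(\mathbf{V}_4)$, with $\mathbf{P}_1,\mathbf{P}_2$ unit vectors in $\mathbf{V}_4=\Gamma(\mathbf{V}_2)$, acting on $\mathbf{V}_4$ by $$\mathbf{Q}\longmapsto \mathbf{P}_1\bigl(\mathbf{P}_2\mathbf{Q}\mathbf{P}_2^{-1}\bigr)\mathbf{P}_1^{-1},\qquad \mathbf{Q}\in\mathbf{V}_4,$$ generate an action of $\mathrm{SO}(\kappa+\kappa'_+,\kappa'_-)$ on $\mathbf{V}_4$; that is, the group of linear transformations of $\mathbf{V}_4$ generated by these maps is $\mathrm{SO}(\mathbf{V}_4)\cong\mathrm{SO}(\kappa+\kappa'_+,\kappa'_-)$.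
   Context: Algebras: $\mathbb{K}$ is one of the normed division algebras $\mathbb{R},\mathbb{C},\mathbb{H},\mathbb{O}$, with conjugation $a\mapsto\bar a$ and positive definite norm $|a|^2=a\bar a$. $\mathbb{K}'$ is one of the split composition algebras $\mathbb{R}'=\mathbb{R}$, $\mathbb{C}'$ (split complex numbers), $\mathbb{H}'$ (split quaternions), $\mathbb{O}'$ (split octonions), with conjugation $A\mapsto A^*$ and norm $|A|^2=AA^*$ of split signature. $\mathcal{K}=\mathbb{K}'\otimes_{\mathbb{R}}\mathbb{K}$ has product $(A\otimes a)(B\otimes b)=AB\otimes ab$; $\mathbb{K}$ and $\mathbb{K}'$ are regarded as commuting subalgebras of $\mathcal{K}$. Set $\kappa=\dim\mathbb{K}$, and let $\kappa'_+\in\{1,1,2,4\}$ and $\kappa'_-\in\{0,1,2,4\}$ be the numbers of positive and negative directions of the norm on $\mathbb{K}'=\mathbb{R}',\mathbb{C}',\mathbb{H}',\mathbb{O}'$ respectively. Matrices: $\mathbf{V}_2$ is the real vector space of $2\times2$ matrices over $\mathcal{K}$ of the form $\mathbf{X}=\begin{pmatrix}A&\bar a\\ a&-A^*\end{pmatrix}$ with $a\in\mathbb{K}$, $A\in\mathbb{K}'$, so that $-\det\mathbf{X}=|A|^2+|a|^2$. Put $\widetilde{\mathbf{X}}=\mathbf{X}-\mathrm{tr}(\mathbf{X})\,\mathbf{I}$ and $\Gamma(\mathbf{X})=\begin{pmatrix}0&\mathbf{X}\\ \widetilde{\mathbf{X}}&0\end{pmatrix}$, so that $\Gamma(\mathbf{X})^2=-\det(\mathbf{X})\,\mathbf{I}$.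 For a $4\times4$ matrix $\mathbf{P}$ over $\mathcal{K}$, $\mathbf{P}_L$ is the real-linear endomorphism $\mathbf{Q}\mapsto\mathbf{P}\mathbf{Q}$ of the space $\mathcal{K}^{4\times4}$ of $4\times4$ matrices over $\mathcal{K}$. The space $\mathbf{V}_4=\{\Gamma(\mathbf{X})_L:\mathbf{X}\in\mathbf{V}_2\}$ is identified with the matrix space $\Gamma(\mathbf{V}_2)$ and carries the quadratic form $|\Gamma(\mathbf{X})|^2=-\det\mathbf{X}$, of signature $(\kappa+\kappa'_+,\kappa'_-)$. A unit vector is $\mathbf{P}\in\mathbf{V}_4$ with $|\mathbf{P}|^2=\pm1$. $\mathrm{C}\ell(\mathbf{V}_4)=\mathrm{C}\ell(\kappa+\kappa'_+,\kappa'_-)$ is realized as the subalgebra of $\mathrm{End}(\mathcal{K}^{4\times4})$ (product: composition) generated by $\mathbf{V}_4$, and $\mathbf{P}\cdot\mathbf{Q}=\mathbf{P}_L\circ\mathbf{Q}_L$ denotes the Clifford product. In the displayed formula the products are matrix products over $\mathcal{K}$; for $\mathbf{P},\mathbf{Q}\in\Gamma(\mathbf{V}_2)$ with $\mathbf{P}=\Gamma(\mathbf{X})$, $\det\mathbf{X}\neq0$, one has $\mathbf{P}^{-1}=(-\det\mathbf{X})^{-1}\mathbf{P}$, and $\mathbf{P}\mathbf{Q}\mathbf{P}^{-1}$ denotes $(\mathbf{P}\mathbf{Q})\mathbf{P}^{-1}=\mathbf{P}(\mathbf{Q}\mathbf{P}^{-1})\in\Gamma(\mathbf{V}_2)$.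 $\mathrm{SO}(\mathbf{V}_4)$ is the group of determinant-one linear isometries of $\mathbf{V}_4$. *)

(* Defs.v *)
From HB Require Import structures.
From mathcomp Require Import all_boot all_order all_algebra.
From mathcomp Require Import reals.

Set Implicit Arguments.
Unset Strict Implicit.
Unset Printing Implicit Defensive.

Import GRing.Theory.

Local Open Scope ring_scope.

(* A not necessarily associative algebra with conjugation, on row vectors of
   coordinates in a basis whose 0-th element is the unit; [idim] is the number
   of remaining ("imaginary") basis elements. *)
Record calgebra (R : comNzRingType) := CAlgebra {
  idim : nat;
  cmul : 'rV[R]_idim.+1 -> 'rV[R]_idim.+1 -> 'rV[R]_idim.+1;
  cconj : 'rV[R]_idim.+1 -> 'rV[R]_idim.+1
}.

Definition base_algebra (R : comNzRingType) : calgebra R :=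
  @CAlgebra R 0 (fun x y => x 0 0 *: y) id.

(* Cayley-Dickson doubling A + A l with l ^ 2 = e:
     (a, b) (c, d) = (a c + e d^* b, d a + b c^* ),   (a, b)^* = (a^*, - b),
   so that |(a, b)|^2 = |a|^2 - e |b|^2. *)
Definition double (R : comNzRingType) (e : R) (A : calgebra R) : calgebra R :=
  let n := (idim A).+1 in
  let fst (x : 'rV[R]_(n + n)) : 'rV_n := lsubmx x in
  let snd (x : 'rV[R]_(n + n)) : 'rV_n := rsubmx x in
  @CAlgebra R (idim A + n)
    (fun x y =>
       row_mx (cmul (fst x) (fst y) + e *: cmul (cconj (snd y)) (snd x))
              (cmul (snd y) (fst x) + cmul (snd x) (cconj (fst y))))
    (fun x => row_mx (cconj (fst x)) (- snd x)).

Inductive hurwitz := Real | Complex | Quaternion | Octonion.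

Definition division_algebra (R : comNzRingType) (k : hurwitz) : calgebra R :=
  match k with
  | Real => base_algebra R
  | Complex => double (-1) (base_algebra R)
  | Quaternion => double (-1) (double (-1) (base_algebra R))
  | Octonion => double (-1) (double (-1) (double (-1) (base_algebra R)))
  end.

Definition split_algebra (R : comNzRingType) (k : hurwitz) : calgebra R :=
  match k with
  | Real => base_algebra R
  | Complex => double 1 (division_algebra R Real)
  | Quaternion => double 1 (division_algebra R Complex)
  | Octonion => double 1 (division_algebra R Quaternion)
  end.

Lemma double_conj_linear (R : comNzRingType) (e : R) (A : calgebra R) :
  linear (@cconj R A) -> linear (@cconj R (double e A)).
Proof.
move=> lin a x y; rewrite /double /= !linearP /= lin.
set n := (idim A).+1.
have E (u v u' v' : 'rV[R]_n) :
    row_mx (a *: u + u') (a *: v + v') = a *: row_mx u v + row_mx u' v'.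
  by rewrite scale_row_mx add_row_mx.
exact: E.
Qed.

Lemma division_conj_linear (R : comNzRingType) k :
  linear (@cconj R (division_algebra R k)).
Proof. by case: k; do ?apply: double_conj_linear; move=> a x y. Qed.

Lemma split_conj_linear (R : comNzRingType) k :
  linear (@cconj R (split_algebra R k)).
Proof. by case: k; do ?apply: double_conj_linear; move=> a x y. Qed.

Definition kappa (k : hurwitz) : nat :=
  match k with Real => 1 | Complex => 2 | Quaternion => 4 | Octonion => 8 end.

Definition kappa_pos (k : hurwitz) : nat :=
  match k with Real => 1 | Complex => 1 | Quaternion => 2 | Octonion => 4 end.

Definition kappa_neg (k : hurwitz) : nat :=
  match k with Real => 0 | Complex => 1 | Quaternion => 2 | Octonion => 4 end.

(* Matrices over a vector space V, as a vector space over the field of scalars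
   of V (the library's module structure on 'M[V] is over a ring V). *)
Definition vmx (R : nzRingType) (V : vectType R) (m n : nat) : Type :=
  'M[V]_(m, n).

Section VMatrix.
Import VectorInternalTheory.
Variables (R : nzRingType) (V : vectType R) (m n : nat).
Implicit Types (M N : vmx V m n) (a b : R).

HB.instance Definition _ := GRing.Zmodule.copy (vmx V m n) 'M[V]_(m, n).

Definition vmx_scale a M : vmx V m n := \matrix_(i, j) (a *: M i j).

Fact vmx_scaleA a b M : vmx_scale a (vmx_scale b M) = vmx_scale (a * b) M.
Proof. by apply/matrixP=> i j; rewrite !mxE scalerA. Qed.
Fact vmx_scale1 : left_id 1 vmx_scale.
Proof. by move=> M; apply/matrixP=> i j; rewrite !mxE scale1r. Qed.
Fact vmx_scaleDr : right_distributive vmx_scale +%R.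
Proof. by move=> a M N; apply/matrixP=> i j; rewrite !mxE scalerDr. Qed.
Fact vmx_scaleDl M : {morph vmx_scale^~ M : a b / a + b}.
Proof. by move=> a b; apply/matrixP=> i j; rewrite !mxE scalerDl. Qed.

HB.instance Definition _ := GRing.Zmodule_isLmodule.Build R (vmx V m n)
  vmx_scaleA vmx_scale1 vmx_scaleDr vmx_scaleDl.

Fact vmx_vect_iso : Vector.axiom (dim {ffun 'I_m * 'I_n -> V}) (vmx V m n).
Proof.
exists (fun M : vmx V m n =>
    v2r [ffun ij : 'I_m * 'I_n => (M ij.1 ij.2 : V)]).
  move=> a M N; rewrite -linearP; congr v2r.
  by apply/ffunP=> ij; rewrite !ffunE !mxE.
exists (fun r => \matrix_(i, j) (r2v r : {ffun 'I_m * 'I_n -> V}) (i, j)).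
  by move=> M; apply/matrixP=> i j; rewrite mxE v2rK ffunE.
move=> r; apply: (canLR r2vK); apply/ffunP=> -[i j].
by rewrite ffunE mxE.
Qed.

HB.instance Definition _ := Lmodule_hasFinDim.Build R (vmx V m n) vmx_vect_iso.

End VMatrix.

Section Theory.
Variables (R : fieldType) (A' A : calgebra R).

(* The tensor product A' (x) A: the entry (i, j) of an element is its
   coordinate on e'_i (x) e_j. *)
Notation tens := 'M[R]_((idim A').+1, (idim A).+1).

Definition pure (x : 'rV[R]_(idim A').+1) (a : 'rV[R]_(idim A).+1) : tens :=
  x^T *m a.

Definition tensl (x : 'rV[R]_(idim A').+1) : tens := pure x (delta_mx 0 0).
Definition tensr (a : 'rV[R]_(idim A).+1) : tens := pure (delta_mx 0 0) a.

Definition tmul (z w : tens) : tens :=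
  \sum_i \sum_j \sum_p \sum_q
    (z i j * w p q) *: pure (cmul (delta_mx 0 i) (delta_mx 0 p))
                            (cmul (delta_mx 0 j) (delta_mx 0 q)).

Notation kmx m n := (vmx tens m n).

Definition kmul m n p (P : kmx m n) (Q : kmx n p) : kmx m p :=
  \matrix_(i, j) \sum_k tmul (P i k) (Q k j).

Definition lmul (P : kmx 4 4) : 'End(kmx 4 4) := linfun (kmul P).

Definition V2_mx (x : 'rV[R]_(idim A').+1) (a : 'rV[R]_(idim A).+1) : kmx 2 2 :=
  block_mx (tensl x)%:M (tensr (cconj a))%:M
           (tensr a)%:M (- tensl (cconj x))%:M :> 'M_(1 + 1).

Definition Gamma (X : kmx 2 2) : kmx 4 4 :=
  block_mx 0 X (X - (\tr X)%:M) 0 :> 'M_(2 + 2).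

Definition V4 : {vspace kmx 4 4} :=
  limg (linfun (fun u : 'rV[R]_(idim A').+1 * 'rV[R]_(idim A).+1 =>
                  Gamma (V2_mx u.1 u.2))).

Definition det2 (X : kmx 2 2) : tens :=
  tmul (X 0 0) (X 1 1) - tmul (X 0 1) (X 1 0).

(* [linfun] is only meaningful on linear maps; the following facts justify the
   two uses above. *)
Lemma linfunE (aT rT : vectType R) (f : aT -> rT) :
  linear f -> forall u, linfun f u = f u.
Proof.
move=> lin_f u.
pose fM := GRing.isLinear.Build R aT rT *:%R f lin_f.
pose fL : {linear aT -> rT} := HB.pack f fM.
exact: (lfunE fL).
Qed.

Lemma tmul_linear (z : tens) : linear (tmul z).
Proof.
move=> a w1 w2; rewrite /tmul.
rewrite scaler_sumr -big_split; apply: eq_bigr => i _ /=.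
rewrite scaler_sumr -big_split; apply: eq_bigr => j _ /=.
rewrite scaler_sumr -big_split; apply: eq_bigr => p _ /=.
rewrite scaler_sumr -big_split; apply: eq_bigr => q _ /=.
by rewrite !mxE mulrDr scalerDl scalerA mulrCA.
Qed.

Lemma kmul_linear m n p (P : kmx m n) : linear (@kmul m n p P).
Proof.
move=> a Q1 Q2; apply/matrixP=> i j; rewrite !mxE scaler_sumr -big_split.
by apply: eq_bigr => k _; rewrite !mxE tmul_linear.
Qed.

Lemma lmulE (P Q : kmx 4 4) : lmul P Q = kmul P Q.
Proof. exact: (linfunE (@kmul_linear _ _ _ P)). Qed.

Lemma V4P : linear (@cconj R A') -> linear (@cconj R A) ->
  forall P, P \in V4 <-> exists x a, P = Gamma (V2_mx x a).
Proof.
move=> lin' lin P.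
have pure_linr x : linear (pure x).
  by move=> a u v; rewrite /pure linearP.
have tensl_lin : linear tensl.
  by move=> a u v; rewrite /tensl /pure linearP /= mulmxDl -scalemxAl.
have V2_lin : linear (fun u : _ * _ => V2_mx u.1 u.2).
  move=> a [x1 a1] [x2 a2]; apply/matrixP=> i j.
  rewrite /V2_mx /tensr /= lin lin' !pure_linr !tensl_lin.
  rewrite !mxE; case: splitP => i' _; rewrite !mxE; case: splitP => j' _;
    by rewrite !mxE !ord1 /= !mulr1n ?opprD ?scalerN.
have Gamma_lin : linear Gamma.
  move=> a X Y; apply/matrixP=> i j.
  rewrite /Gamma /= !mxE; case: splitP => i' _; rewrite !mxE;
    case: splitP => j' _; rewrite !mxE ?scaler0 ?addr0 //.
  rewrite /mxtrace !big_ord_recl !big_ord0 !mxE !addr0.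
  case: (i' == j'); rewrite ?mulr1n ?mulr0n ?subr0 //.
  by rewrite scalerBr scalerDr [in LHS](addrACA (_ *: _)) opprD addrACA.
have lin_f : linear (fun u : 'rV[R]_(idim A').+1 * 'rV[R]_(idim A).+1 =>
    Gamma (V2_mx u.1 u.2)) by move=> a u v; rewrite V2_lin Gamma_lin.
split=> [/memv_imgP[[x a] _]|[x [a ->]]].
  by rewrite (linfunE lin_f) => ->; exists x, a.
apply/memv_imgP; exists (x, a); first exact: memvf.
by rewrite (linfunE lin_f).
Qed.

(* |Gamma(X)|^2 = - det X.  For X in V_2, det X is a real multiple of the unit
   of the tensor product; [0 0] reads off its coordinate on the unit. *)
Definition qform (P : kmx 4 4) : R :=
  - det2 (ursubmx (P : 'M_(2 + 2))) 0 0.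

Definition unit_vector (P : kmx 4 4) : Prop :=
  P \in V4 /\ (qform P = 1 \/ qform P = -1).

Definition kinv (P : kmx 4 4) : kmx 4 4 := (qform P)^-1 *: P.

Definition kconj (P Q : kmx 4 4) : kmx 4 4 := kmul (kmul P Q) (kinv P).

(* The unital subalgebra of End(K^(4x4)) generated by the left multiplications
   by elements of V4. *)
Definition in_clifford (c : 'End(kmx 4 4)) : Prop :=
  forall S : {vspace 'End(kmx 4 4)},
    \1%VF \in S ->
    (forall f g, f \in S -> g \in S -> (f \o g)%VF \in S) ->
    (forall P, P \in V4 -> lmul P \in S) ->
  c \in S.

Definition second_order (c : 'End(kmx 4 4)) : Prop :=
  in_clifford c /\
  exists P1 P2, [/\ unit_vector P1, unit_vector P2 & c = (lmul P1 \o lmul P2)%VF].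

(* f is the transformation of V4 by which the Clifford element c acts, for any
   factorization of c as a product of two unit vectors. *)
Definition acts_by (c : 'End(kmx 4 4)) (f : 'End(subvs_of V4)) : Prop :=
  forall P1 P2, unit_vector P1 -> unit_vector P2 -> c = (lmul P1 \o lmul P2)%VF ->
  forall Q : subvs_of V4, vsval (f Q) = kconj P1 (kconj P2 (vsval Q)).

End Theory.

Inductive generated (K : fieldType) (V : vectType K) (S : 'End(V) -> Prop) :
    'End(V) -> Prop :=
  | gen_in f of S f : generated S f
  | gen_id : generated S \1%VF
  | gen_comp f g of generated S f & generated S g : generated S (f \o g)%VF
  | gen_inv f g of generated S f & (f \o g)%VF = \1%VF & (g \o f)%VF = \1%VF :
      generated S g.

(* The matrix, on column vectors, of an endomorphism in the basis b. *)
Definition mx_of_end (K : fieldType) (V : vectType K) n (b : n.-tuple V)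
    (f : 'End(V)) : 'M[K]_n :=
  \matrix_(i, j) coord b i (f b`_j).

Definition SO_of (K : fieldType) (V : vectType K) (q : V -> K) (f : 'End(V)) :
    Prop :=
  (forall v, q (f v) = q v) /\ \det (mx_of_end (vbasis {:V}) f) = 1.

Definition SO_V4 (R : fieldType) (A' A : calgebra R)
    (f : 'End(subvs_of (V4 A' A))) : Prop :=
  SO_of (fun Q => qform (vsval Q)) f.

Definition SO_pq (R : fieldType) (p q : nat) (M : 'M[R]_(p + q)) : Prop :=
  let eta : 'M[R]_(p + q) := block_mx 1%:M 0 0 (- 1%:M) in
  M^T *m eta *m M = eta /\ \det M = 1.

Definition group_iso (S T : Type) (mulS : S -> S -> S) (mulT : T -> T -> T)
    (G : S -> Prop) (H : T -> Prop) (phi : S -> T) : Prop :=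
  [/\ forall f, G f -> H (phi f),
      forall f g, G f -> G g -> phi (mulS f g) = mulT (phi f) (phi g),
      forall f g, G f -> G g -> phi f = phi g -> f = g &
      forall M, H M -> exists2 f, G f & phi f = M].

(* Main.v *)
Require Import Defs.
From mathcomp Require Import all_boot all_order all_algebra.
From mathcomp Require Import reals ring.

Set Implicit Arguments.
Unset Strict Implicit.
Unset Printing Implicit Defensive.

Import Order.TTheory GRing.Theory Num.Theory.

Local Open Scope ring_scope.

(** Write P for Gamma(X), with X in V_2 given by A in K' and a in K, and q for
the quadratic form |P|^2 = |A|^2 + |a|^2 on V_4.

The two factors enter only through the laws gathered in [composition]: besides
bilinearity, a unit and an anti-involution, the identities
a^* (a b) = N(a) b = (b a) a^*, which survive in the octonions although
associativity does not.  They give P (P Z) = q(P) Z = (Z P) P for every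
matrix Z ([V4_sq_l], [V4_sq_r]): in each entry the mixed products of A and a
cancel since K' and K commute, and the remaining terms collapse to |A|^2 and
|a|^2.

Polarizing in P, with beta(P, Q) = q(P + Q) - q(P) - q(Q), yields the Clifford
relation P (Q Z) + Q (P Z) = beta(P, Q) Z, whence
P Q P^-1 = beta(P, Q) / q(P) P - Q ([kconjE]), which is minus the reflection in
the hyperplane orthogonal to P.  The two signs cancel in a product of two such
maps, so P_1 . P_2 acts by the product of two reflections.  That map depends
on the Clifford element c alone, and not on the factorization: the relation
P (Q Z) = (P Q P^-1) (P Z) says that c intertwines left multiplication by Q
with left multiplication by the image of Q, and c is invertible
([kconj_pair_eq]).

It remains to see that products of pairs of unit reflections make up the
special orthogonal group of a real quadratic space with a basis that is
orthonormal up to signs ([SO_generated_rotations]).  A reflection has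
determinant -1, and every isometry is a product of reflections
([cartan_dieudonne]); determinant 1 forces an even number of them.  For the
last step, the basis of V_4 that comes from the coordinates of a and A is
orthonormal up to signs, with the positive vectors first, and the matrix in
that basis identifies SO(V_4) with SO(p, q) ([SO_V4_iso]). *)

(** * Composition algebras and their Cayley-Dickson doubles *)

Section Composition.
Variable R : comNzRingType.

(** Associativity is replaced by the last two laws, that is, by alternativity
combined with N(x) = x^* x. *)
Record composition (A : calgebra R) (N : 'rV[R]_(idim A).+1 -> R) : Prop := {
  cmulDl x y z : cmul (x + y) z = cmul x z + cmul y z :> 'rV[R]_(idim A).+1;
  cmulDr x y z : cmul x (y + z) = cmul x y + cmul x z :> 'rV[R]_(idim A).+1;
  cmulZl a x y : cmul (a *: x) y = a *: cmul x y :> 'rV[R]_(idim A).+1;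
  cmulZr a x y : cmul x (a *: y) = a *: cmul x y :> 'rV[R]_(idim A).+1;
  cconjD x y : cconj (x + y) = cconj x + cconj y :> 'rV[R]_(idim A).+1;
  cconjZ a x : cconj (a *: x) = a *: cconj x :> 'rV[R]_(idim A).+1;
  cmul1l x : cmul (delta_mx 0 0) x = x :> 'rV[R]_(idim A).+1;
  cmul1r x : cmul x (delta_mx 0 0) = x :> 'rV[R]_(idim A).+1;
  cconjK x : cconj (cconj x) = x :> 'rV[R]_(idim A).+1;
  cconjM x y : cconj (cmul x y) = cmul (cconj y) (cconj x) :> 'rV[R]_(idim A).+1;
  cmul_conjKl x y : cmul (cconj x) (cmul x y) = N x *: y;
  cmul_conjKr x y : cmul (cmul y x) (cconj x) = N x *: y
}.

Section Derived.
Variables (A : calgebra R) (N : 'rV[R]_(idim A).+1 -> R).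
Hypothesis cA : composition N.
Notation V := 'rV[R]_(idim A).+1.
Implicit Types x y : V.

Lemma cmulNl x y : cmul (- x) y = - cmul x y.
Proof. by rewrite -scaleN1r (cmulZl cA) scaleN1r. Qed.

Lemma cmulNr x y : cmul x (- y) = - cmul x y.
Proof. by rewrite -scaleN1r (cmulZr cA) scaleN1r. Qed.

Lemma cconjN x : cconj (- x) = - cconj x.
Proof. by rewrite -scaleN1r (cconjZ cA) scaleN1r. Qed.

Lemma cmul0l x : cmul 0 x = 0.
Proof. by have := cmulZl cA 0 0 x; rewrite !scale0r. Qed.

Lemma cmul0r x : cmul x 0 = 0.
Proof. by have := cmulZr cA 0 x 0; rewrite !scale0r. Qed.

Lemma cconj0 : cconj 0 = 0 :> V.
Proof. by have := cconjZ cA 0 0; rewrite !scale0r. Qed.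

Lemma cconj1 : cconj (delta_mx 0 0) = delta_mx 0 0 :> V.
Proof.
rewrite -[LHS](cmul1l cA) -[X in cmul X _](cconjK cA) -(cconjM cA).
by rewrite (cmul1l cA) (cconjK cA).
Qed.

Lemma cmul_conjl x : cmul (cconj x) x = N x *: delta_mx 0 0.
Proof. by rewrite -(cmul_conjKl cA) (cmul1r cA). Qed.

Lemma cmul_conjr x : cmul x (cconj x) = N x *: delta_mx 0 0.
Proof. by rewrite -(cmul_conjKr cA) (cmul1l cA). Qed.

(** Both sides are the scalar of x x^*, computed by the left law at x^* and by
the right law at x. *)
Lemma norm_conj x : N (cconj x) = N x.
Proof.
have := cmul_conjl (cconj x); rewrite (cconjK cA) cmul_conjr.
by move=> /matrixP/(_ 0 0); rewrite !mxE !eqxx !mulr1.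
Qed.

Lemma cconjKl x y : cmul x (cmul (cconj x) y) = N x *: y.
Proof. by rewrite -norm_conj -(cmul_conjKl cA) (cconjK cA). Qed.

Lemma cconjKr x y : cmul (cmul y (cconj x)) x = N x *: y.
Proof. by rewrite -norm_conj -(cmul_conjKr cA) (cconjK cA). Qed.

End Derived.

Section Double.
Variables (e : R) (A : calgebra R) (N : 'rV[R]_(idim A).+1 -> R).
Hypothesis cA : composition N.
Notation n := (idim A).+1.
Notation V := 'rV[R]_n.
Implicit Types a b c d : V.

Definition dbl a b : 'rV[R]_(idim (Defs.double e A)).+1 := row_mx a b.

Definition double_norm (x : 'rV[R]_(idim (Defs.double e A)).+1) : R :=
  N (lsubmx (x : 'rV_(n + n))) - e * N (rsubmx (x : 'rV_(n + n))).

Lemma dblP (x : 'rV[R]_(idim (Defs.double e A)).+1) : exists a b, x = dbl a b.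
Proof.
exists (lsubmx (x : 'rV_(n + n))), (rsubmx (x : 'rV_(n + n))).
by rewrite /dbl hsubmxK.
Qed.

Lemma dblM a b c d : cmul (dbl a b) (dbl c d) =
  dbl (cmul a c + e *: cmul (cconj d) b) (cmul d a + cmul b (cconj c)).
Proof. by rewrite /dbl /= !row_mxKl !row_mxKr. Qed.

Lemma dbl_conj a b : cconj (dbl a b) = dbl (cconj a) (- b).
Proof. by rewrite /dbl /= !row_mxKl !row_mxKr. Qed.

Lemma dblD a b c d : dbl a b + dbl c d = dbl (a + c) (b + d).
Proof. exact: (add_row_mx (n1 := n)). Qed.

Lemma dblZ r a b : r *: dbl a b = dbl (r *: a) (r *: b).
Proof. exact: (scale_row_mx (n1 := n)). Qed.

Lemma dbl1 : delta_mx 0 0 = dbl (delta_mx 0 0) 0.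
Proof.
apply/rowP=> i; rewrite /dbl.
rewrite [RHS]mxE; case: splitP => j E; rewrite !mxE !eqxx /=.
  by rewrite -!val_eqE /= E.
by rewrite -val_eqE /= E.
Qed.

Lemma double_normE a b : double_norm (dbl a b) = N a - e * N b.
Proof. by rewrite /double_norm /dbl row_mxKl row_mxKr. Qed.

Let D := (cmulDl cA, cmulDr cA, cmulZl cA, cmulZr cA, cconjD cA, cconjZ cA,
  cmulNl cA, cmulNr cA, cconjN cA).

(** The ladder real, complex, quaternion, octonion loses one law at each
doubling: the double is commutative if A is commutative with trivial
conjugation, associative if A is associative and commutative, and a composition
algebra as soon as A is associative. *)
Lemma double_comm : (forall a, cconj a = a) -> commutative (@cmul R A) ->
  commutative (@cmul R (Defs.double e A)).
Proof.
move=> J C x y; have [a [b ->]] := dblP x; have [c [d ->]] := dblP y.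
by rewrite !dblM !J (C c a) (C b d) addrC [in RHS]addrC; congr dbl; rewrite addrC.
Qed.

Lemma double_assoc : associative (@cmul R A) -> commutative (@cmul R A) ->
  associative (@cmul R (Defs.double e A)).
Proof.
move=> As C x y z; have [a [b ->]] := dblP x; have [c [d ->]] := dblP y.
have [f [g ->]] := dblP z.
rewrite !dblM !D !(cconjM cA) !(cconjK cA) !scalerDr !addrA; congr dbl.
  have -> : cmul (cmul (cconj d) b) f = cmul (cmul f (cconj d)) b by rewrite C As.
  have -> : cmul (cconj g) (cmul d a) = cmul a (cmul (cconj g) d) by rewrite As C.
  have -> : cmul (cconj g) (cmul b (cconj c)) = cmul (cmul (cconj c) (cconj g)) b.
    by rewrite (C b) As (C (cconj g)).
  by rewrite As addrAC; congr (_ + _); apply: addrAC.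
have -> : cmul (cmul d (cconj f)) a = cmul (cmul d a) (cconj f).
  by rewrite -!As (C a).
have -> : cmul b (cmul (cconj f) (cconj c)) = cmul (cmul b (cconj c)) (cconj f).
  by rewrite (C (cconj f)) As.
have -> : cmul b (cmul (cconj d) g) = cmul g (cmul (cconj d) b).
  by rewrite As C (C b).
by rewrite -!As (C c a) [LHS]addrAC; congr (_ + _); apply: addrAC.
Qed.

(** In x^* (x y) and (y x) x^*, with x = (a, b), the products that mix a and b
cancel in pairs once they are reassociated; this is the only use of the
associativity of A.  What remains is N(a) - e N(b). *)
Lemma double_composition : associative (@cmul R A) ->
  composition (A := Defs.double e A) double_norm.
Proof.
move=> As; split=> [x y z|x y z|r x y|r x y|x y|r x|x|x|x|x y|x y|x y];
  have [a [b ->]] := dblP x.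
- have [c [d ->]] := dblP y; have [f [g ->]] := dblP z.
  rewrite !(dblM, dblD) !D; congr dbl; last by rewrite addrACA.
  by rewrite scalerDr addrACA.
- have [c [d ->]] := dblP y; have [f [g ->]] := dblP z.
  rewrite !(dblM, dblD) !D; congr dbl; last by rewrite addrACA.
  by rewrite scalerDr addrACA.
- have [c [d ->]] := dblP y.
  by rewrite !(dblM, dblZ) !D !scalerDr !scalerA mulrC.
- have [c [d ->]] := dblP y.
  by rewrite !(dblM, dblZ) !D !scalerDr !scalerA mulrC.
- have [c [d ->]] := dblP y.
  by rewrite !(dbl_conj, dblD) !D opprD.
- by rewrite !(dbl_conj, dblZ) !D scalerN.
- by rewrite dbl1 dblM !(cmul1l cA) !(cmul0l cA) !(cmul0r cA) !(cmul1r cA) scaler0 !addr0.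
- rewrite dbl1 dblM (cconj1 cA) !(cmul1r cA) (cconj0 cA) !(cmul0l cA).
  by rewrite scaler0 addr0 add0r.
- by rewrite !dbl_conj (cconjK cA) opprK.
- have [c [d ->]] := dblP y.
  rewrite !(dbl_conj, dblM) !D !(cconjM cA) !(cconjK cA) opprK opprD.
  by congr dbl; rewrite addrC.
- have [c [d ->]] := dblP y.
  rewrite dbl_conj !dblM double_normE dblZ !D !(cconjM cA) !(cconjK cA).
  rewrite (cmul_conjKl cA) (cmul_conjKr cA) (cconjKl cA) (cconjKr cA) !As.
  rewrite (scalerN e) scalerDr !opprD !addrA !addrK.
  by rewrite !scalerBl !scalerA.
- have [c [d ->]] := dblP y.
  rewrite dbl_conj !dblM double_normE dblZ !D (cconjK cA).
  rewrite (cmul_conjKl cA) (cmul_conjKr cA) (cconjKl cA) (cconjKr cA) !As.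
  rewrite (scalerN e) scalerDr !scalerN !scalerBl !scalerA; congr dbl.
    by rewrite addrACA addrN addr0.
  by rewrite addrACA addNr add0r addrC.
Qed.

End Double.

Definition sum_sq n (x : 'rV[R]_n) : R := \sum_i x 0 i ^+ 2.

Lemma composition_ext (A : calgebra R) (N N' : 'rV[R]_(idim A).+1 -> R) :
  N =1 N' -> composition N -> composition N'.
Proof. by move=> E [*]; split=> // x y; rewrite -E. Qed.

Lemma base_composition : composition (A := base_algebra R) (@sum_sq 1).
Proof.
by split=> //= *; apply/rowP=> i; rewrite [i]ord1 /sum_sq ?big_ord1 !mxE /=; ring.
Qed.

Lemma double_sum_sq (A : calgebra R) :
  double_norm (e := -1) (@sum_sq (idim A).+1) =1 @sum_sq _.
Proof.
move=> x; rewrite /double_norm /sum_sq mulN1r opprK.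
rewrite [RHS](big_split_ord _ (m := (idim A).+1) (n := (idim A).+1)) /=.
by congr (_ + _); apply: eq_bigr => i _; rewrite mxE.
Qed.

Lemma double_composition_sum_sq (A : calgebra R) :
  composition (A := A) (@sum_sq _) -> associative (@cmul R A) ->
  composition (A := Defs.double (-1) A) (@sum_sq _).
Proof.
move=> cA As.
exact: composition_ext (@double_sum_sq A) (double_composition (-1) cA As).
Qed.

Lemma base_mulC : commutative (@cmul R (base_algebra R)).
Proof. by move=> x y; apply/rowP=> i; rewrite !ord1 !mxE mulrC. Qed.

Lemma base_mulA : associative (@cmul R (base_algebra R)).
Proof. by move=> x y z; apply/rowP=> i; rewrite !ord1 !mxE mulrA. Qed.

Lemma division_assoc_composition k : k <> Octonion ->
  associative (@cmul R (division_algebra R k)) /\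
  composition (A := division_algebra R k) (@sum_sq _).
Proof.
have cR := base_composition; have asR := base_mulA.
have cC := double_composition_sum_sq cR asR.
have asC := double_assoc cR asR base_mulC.
have comC e : commutative (@cmul R (Defs.double e (base_algebra R))).
  exact: double_comm base_mulC.
case: k => [_|_|_|/(_ erefl)//]; split.
- exact: asR.
- exact: cR.
- exact: asC.
- exact: double_composition_sum_sq cR asR.
- exact: double_assoc cC (asC _) (comC _).
- exact: double_composition_sum_sq cC (asC _).
Qed.

Lemma division_composition k :
  composition (A := division_algebra R k) (@sum_sq _).
Proof.
have [->|] : k = Octonion \/ k <> Octonion by case: k; [right|right|right|left].
  have [//|asH cH] := @division_assoc_composition Quaternion.
  exact: double_composition_sum_sq cH asH.
by case/division_assoc_composition.
Qed.

(** The norm of a split algebra, with p the number of coordinates before the last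
doubling: the part adjoined with e = 1 carries the sign -. *)
Definition signed_sq p n (x : 'rV[R]_n) : R :=
  \sum_(i < n) (if (i < p)%N then 1 else -1) * x 0 i ^+ 2.

Lemma double_signed_sq (A : calgebra R) :
  double_norm (e := 1) (@sum_sq (idim A).+1) =1 @signed_sq (idim A).+1 _.
Proof.
move=> x; rewrite /double_norm /sum_sq mul1r -sumrN.
rewrite [RHS](big_split_ord _ (m := (idim A).+1) (n := (idim A).+1)) /=.
congr (_ + _); apply: eq_bigr => i _; rewrite mxE /=.
  by rewrite ltn_ord mul1r.
by rewrite ltnNge leq_addr mulN1r.
Qed.

Lemma split_composition k :
  composition (A := split_algebra R k) (@signed_sq (kappa_pos k) _).
Proof.
have D j : j <> Octonion -> composition (A := Defs.double 1 (division_algebra R j))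
    (@signed_sq (idim (division_algebra R j)).+1 _).
  case/division_assoc_composition => As cA.
  exact: composition_ext (@double_signed_sq _) (double_composition 1 cA As).
case: k; [|exact: (D Defs.Real)|exact: (D Defs.Complex)|exact: (D Defs.Quaternion)].
apply: composition_ext base_composition => x.
by rewrite /sum_sq /signed_sq !big_ord1 mul1r.
Qed.

Lemma division_dim k : (idim (division_algebra R k)).+1 = kappa k.
Proof. by case: k. Qed.

Lemma split_dim k :
  (idim (split_algebra R k)).+1 = (kappa_pos k + kappa_neg k)%N.
Proof. by case: k. Qed.

End Composition.

(** * Linear extension *)

Section LinearExtension.
Variables (R : nzRingType) (V : lmodType R).

(** The maps below are linear only propositionally, with no canonical linear
structure to trigger the generic lemmas, hence these versions. *)
Lemma linear_on_sum (U : lmodType R) (f : U -> V) : linear f ->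
  forall n (F : 'I_n -> U), f (\sum_i F i) = \sum_i f (F i).
Proof.
move=> lf; have f0 : f 0 = 0.
  by have := lf (-1) 0 0; rewrite !scaleN1r !addNr.
elim=> [|n IH] F; first by rewrite !big_ord0.
by rewrite !big_ord_recl /= -IH -[X in f (X + _)]scale1r lf scale1r.
Qed.

Lemma linear_on_scale (U : lmodType R) (f : U -> V) : linear f ->
  forall a u, f (a *: u) = a *: f u.
Proof.
move=> lf a u; have f0 : f 0 = 0.
  by have := lf (-1) 0 0; rewrite !scaleN1r !addNr.
by rewrite -[a *: u]addr0 lf f0 addr0.
Qed.

Lemma linear_eq_row n (f g : 'rV[R]_n -> V) : linear f -> linear g ->
  (forall i, f (delta_mx 0 i) = g (delta_mx 0 i)) -> f =1 g.
Proof.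
move=> lf lg E x; rewrite [x]row_sum_delta !linear_on_sum //.
by apply: eq_bigr => i _; rewrite !linear_on_scale // E.
Qed.

(** Elements of a tensor product are matrices of coordinates here, and the pure
tensors x^T *m a span them. *)
Lemma linear_eq_tensor m n (f g : 'M[R]_(m, n) -> V) : linear f -> linear g ->
  (forall (x : 'rV_m) (a : 'rV_n), f (x^T *m a) = g (x^T *m a)) -> f =1 g.
Proof.
move=> lf lg E z; rewrite [z]matrix_sum_delta !linear_on_sum //.
apply: eq_bigr => i _; rewrite !linear_on_sum //; apply: eq_bigr => j _.
by rewrite !linear_on_scale // -(mul_delta_mx (0 : 'I_1)) -trmx_delta E.
Qed.
End LinearExtension.

(** * Products with elements of the two factors *)

Section Tensor.
Variables (R : fieldType) (A' A : calgebra R).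
Variables (N' : 'rV[R]_(idim A').+1 -> R) (N : 'rV[R]_(idim A).+1 -> R).
Hypotheses (cA' : composition N') (cA : composition N).
Notation tens := 'M[R]_((idim A').+1, (idim A).+1).
Notation tmul := (@tmul R A' A).
Notation pure := (@pure R A' A).
Notation tensl := (@tensl R A' A).
Notation tensr := (@tensr R A' A).
Implicit Types (z w : tens) (x y : 'rV[R]_(idim A').+1) (a b : 'rV[R]_(idim A).+1).

Lemma pure_linear_l a : linear (pure^~ a).
Proof. by move=> r x y; rewrite /pure linearP /= mulmxDl -scalemxAl. Qed.

Lemma pure_linear_r x : linear (pure x).
Proof. by move=> r a b; rewrite /pure linearP. Qed.

Lemma tmul_linear_l w : linear (tmul^~ w).
Proof.
move=> r z1 z2; rewrite /Defs.tmul.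
do 4!(rewrite scaler_sumr -big_split; apply: eq_bigr => ? _ /=).
by rewrite !mxE mulrDl scalerDl scalerA mulrA.
Qed.

Lemma tmulDl z1 z2 w : tmul (z1 + z2) w = tmul z1 w + tmul z2 w.
Proof. by have := tmul_linear_l w 1 z1 z2; rewrite !scale1r. Qed.

Lemma tmulDr z w1 w2 : tmul z (w1 + w2) = tmul z w1 + tmul z w2.
Proof. by have := tmul_linear z 1 w1 w2; rewrite !scale1r. Qed.

Lemma tmulZl r z w : tmul (r *: z) w = r *: tmul z w.
Proof. exact: (linear_on_scale (tmul_linear_l w)). Qed.

Lemma tmulZr r z w : tmul z (r *: w) = r *: tmul z w.
Proof. exact: (linear_on_scale (tmul_linear z)). Qed.

Lemma tmulNl z w : tmul (- z) w = - tmul z w.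
Proof. by rewrite -scaleN1r tmulZl scaleN1r. Qed.

Lemma tmulNr z w : tmul z (- w) = - tmul z w.
Proof. by rewrite -scaleN1r tmulZr scaleN1r. Qed.

Lemma tmul0l w : tmul 0 w = 0.
Proof. by have := tmulZl 0 0 w; rewrite !scale0r. Qed.

Lemma tmul0r z : tmul z 0 = 0.
Proof. by have := tmulZr 0 z 0; rewrite !scale0r. Qed.

Lemma tmul_delta i j p q : tmul (delta_mx i j) (delta_mx p q) =
  pure (cmul (delta_mx 0 i) (delta_mx 0 p)) (cmul (delta_mx 0 j) (delta_mx 0 q)).
Proof.
rewrite /Defs.tmul (bigD1 i) //= (bigD1 j) //= (bigD1 p) //= (bigD1 q) //=.
rewrite !big1 ?addr0 => [|i' /negbTE H|j' /negbTE H|p' /negbTE H|q' /negbTE H].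
- by rewrite !mxE !eqxx mulr1 scale1r.
- do 3![apply: big1 => ? _]; by rewrite !mxE H mul0r scale0r.
- do 2![apply: big1 => ? _]; by rewrite !mxE H andbF mul0r scale0r.
- by apply: big1 => ? _; rewrite !mxE H mulr0 scale0r.
- by rewrite !mxE H andbF mulr0 scale0r.
Qed.

Lemma tmul_pure x a y b : tmul (pure x a) (pure y b) = pure (cmul x y) (cmul a b).
Proof.
have lP := (pure_linear_l, pure_linear_r).
move: x; apply: linear_eq_row => [r u v|r u v|i].
- by rewrite !lP tmul_linear_l.
- by rewrite (cmulDl cA') (cmulZl cA') lP.
move: a; apply: linear_eq_row => [r u v|r u v|j].
- by rewrite !lP tmul_linear_l.
- by rewrite (cmulDl cA) (cmulZl cA) lP.
move: y; apply: linear_eq_row => [r u v|r u v|p].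
- by rewrite !lP tmul_linear.
- by rewrite (cmulDr cA') (cmulZr cA') lP.
move: b; apply: linear_eq_row => [r u v|r u v|q].
- by rewrite !lP tmul_linear.
- by rewrite (cmulDr cA) (cmulZr cA) lP.
by rewrite /Defs.pure !trmx_delta !mul_delta_mx tmul_delta.
Qed.

Definition tensor_one : tens := pure (delta_mx 0 0) (delta_mx 0 0).

(* The linearity side conditions of [linear_eq_tensor] in the identities below
   are closed by these four facts. *)
Let lin2l u v : linear (fun z => tmul u (tmul v z)).
Proof. by move=> r z w; rewrite !tmul_linear. Qed.
Let lin2r u v : linear (fun z => tmul (tmul z u) v).
Proof. by move=> r z w; rewrite !tmul_linear_l. Qed.
Let linZ s : linear (fun z : tens => s *: z).
Proof. by move=> r z w; rewrite scalerDr !scalerA mulrC. Qed.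
Let linid : linear (fun z : tens => z).
Proof. by []. Qed.

Let one := (cmul1l cA, cmul1r cA, cmul1l cA', cmul1r cA').

Lemma tmul1l z : tmul tensor_one z = z.
Proof.
move: z; apply: linear_eq_tensor => [||x a]; [exact: tmul_linear|exact: linid|].
by rewrite tmul_pure !one.
Qed.

Lemma tmul1r z : tmul z tensor_one = z.
Proof.
move: z; apply: linear_eq_tensor => [||x a]; [exact: tmul_linear_l|exact: linid|].
by rewrite tmul_pure !one.
Qed.

Let pureZl r x a : pure (r *: x) a = r *: pure x a.
Proof. exact: (linear_on_scale (pure_linear_l a)). Qed.
Let pureZr r x a : pure x (r *: a) = r *: pure x a.
Proof. exact: (linear_on_scale (pure_linear_r x)). Qed.

Lemma tensl_conjKl x z : tmul (tensl (cconj x)) (tmul (tensl x) z) = N' x *: z.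
Proof.
move: z; apply: linear_eq_tensor => [||y a]; rewrite // -/(pure y a).
by rewrite !tmul_pure !one (cmul_conjKl cA') pureZl.
Qed.

Lemma tensl_conjKr x z : tmul (tmul z (tensl x)) (tensl (cconj x)) = N' x *: z.
Proof.
move: z; apply: linear_eq_tensor => [||y a]; rewrite // -/(pure y a).
by rewrite !tmul_pure !one (cmul_conjKr cA') pureZl.
Qed.

Lemma conj_tenslKl x z : tmul (tensl x) (tmul (tensl (cconj x)) z) = N' x *: z.
Proof. by rewrite -(norm_conj cA') -tensl_conjKl (cconjK cA'). Qed.

Lemma conj_tenslKr x z : tmul (tmul z (tensl (cconj x))) (tensl x) = N' x *: z.
Proof. by rewrite -(norm_conj cA') -tensl_conjKr (cconjK cA'). Qed.

Lemma tensr_conjKl a z : tmul (tensr (cconj a)) (tmul (tensr a) z) = N a *: z.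
Proof.
move: z; apply: linear_eq_tensor => [||y b]; rewrite // -/(pure y b).
by rewrite !tmul_pure !one (cmul_conjKl cA) pureZr.
Qed.

Lemma tensr_conjKr a z : tmul (tmul z (tensr a)) (tensr (cconj a)) = N a *: z.
Proof.
move: z; apply: linear_eq_tensor => [||y b]; rewrite // -/(pure y b).
by rewrite !tmul_pure !one (cmul_conjKr cA) pureZr.
Qed.

Lemma conj_tensrKl a z : tmul (tensr a) (tmul (tensr (cconj a)) z) = N a *: z.
Proof. by rewrite -(norm_conj cA) -tensr_conjKl (cconjK cA). Qed.

Lemma conj_tensrKr a z : tmul (tmul z (tensr (cconj a))) (tensr a) = N a *: z.
Proof. by rewrite -(norm_conj cA) -tensr_conjKr (cconjK cA). Qed.

(** The next two lemmas are the sense in which K' and K commute inside the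
nonassociative tensor product. *)
Lemma tens_lrC x a z : tmul (tensl x) (tmul (tensr a) z) =
  tmul (tensr a) (tmul (tensl x) z).
Proof.
move: z; apply: linear_eq_tensor => [||y b]; rewrite // -/(pure y b).
by rewrite !tmul_pure !one.
Qed.

Lemma tens_rlC x a z : tmul (tmul z (tensl x)) (tensr a) =
  tmul (tmul z (tensr a)) (tensl x).
Proof.
move: z; apply: linear_eq_tensor => [||y b]; rewrite // -/(pure y b).
by rewrite !tmul_pure !one.
Qed.

(** * The Clifford relation *)

Notation kmx m n := (vmx tens m n).
Notation G := (fun x a => Gamma (@V2_mx R A' A x a)).

Lemma kmul_linear_l m n p (Q : kmx n p) : linear ((@kmul R A' A m n p)^~ Q).
Proof.
move=> r P1 P2; apply/matrixP=> i j; rewrite !mxE scaler_sumr -big_split.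
by apply: eq_bigr => k _; rewrite !mxE tmul_linear_l.
Qed.

Definition kmx_one n : kmx n n := \matrix_(i, j) if i == j then tensor_one else 0.

Lemma kmul1l n p (P : kmx n p) : kmul (kmx_one n) P = P.
Proof.
apply/matrixP=> i j; rewrite mxE (bigD1 i) //= big1 ?addr0 => [|k ne].
  by rewrite mxE eqxx tmul1l.
by rewrite mxE eq_sym (negbTE ne) tmul0l.
Qed.

Lemma kmul1r m n (P : kmx m n) : kmul P (kmx_one n) = P.
Proof.
apply/matrixP=> i j; rewrite mxE (bigD1 j) //= big1 ?addr0 => [|k ne].
  by rewrite mxE eqxx tmul1r.
by rewrite mxE (negbTE ne) tmul0r.
Qed.

(* The indices of a 4 x 4 matrix, as its iterated block structure sees them. *)
Let i0 : 'I_4 := lshift 2 (lshift 1 (ord0 : 'I_1)).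
Let i1 : 'I_4 := lshift 2 (rshift 1 (ord0 : 'I_1)).
Let i2 : 'I_4 := rshift 2 (lshift 1 (ord0 : 'I_1)).
Let i3 : 'I_4 := rshift 2 (rshift 1 (ord0 : 'I_1)).

Lemma ord4P (P : 'I_4 -> Prop) : P i0 -> P i1 -> P i2 -> P i3 -> forall i, P i.
Proof.
move=> H0 H1 H2 H3 i.
have [j ->|j ->] := @split_ordP 2 2 i; have [l ->|l ->] := @split_ordP 1 1 j;
  by rewrite ord1.
Qed.

Lemma sum4 (F : 'I_4 -> tens) : \sum_i F i = F i0 + F i1 + F i2 + F i3.
Proof.
rewrite (big_split_ord _ (m := 2) (n := 2)) /=.
rewrite (big_split_ord _ (m := 1) (n := 1)) /=.
rewrite (big_split_ord _ (m := 1) (n := 1)) /=.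
by rewrite !big_ord1 !addrA.
Qed.

Let j0 : 'I_2 := lshift 1 (ord0 : 'I_1).
Let j1 : 'I_2 := rshift 1 (ord0 : 'I_1).

Lemma V2_mxE x a (X := @V2_mx R A' A x a) :
  [/\ X j0 j0 = tensl x, X j0 j1 = tensr (cconj a),
      X j1 j0 = tensr a & X j1 j1 = - tensl (cconj x)].
Proof.
split.
- by rewrite [LHS](@block_mxEul _ 1 1 1 1) mxE.
- by rewrite [LHS](@block_mxEur _ 1 1 1 1) mxE.
- by rewrite [LHS](@block_mxEdl _ 1 1 1 1) mxE.
- by rewrite [LHS](@block_mxEdr _ 1 1 1 1) mxE.
Qed.

Lemma GammaE x a (P := G x a) :
  [/\ [/\ P i0 i0 = 0, P i0 i1 = 0, P i0 i2 = tensl x & P i0 i3 = tensr (cconj a)],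
      [/\ P i1 i0 = 0, P i1 i1 = 0, P i1 i2 = tensr a & P i1 i3 = - tensl (cconj x)],
      [/\ P i2 i0 = tensl (cconj x), P i2 i1 = tensr (cconj a), P i2 i2 = 0 & P i2 i3 = 0] &
      [/\ P i3 i0 = tensr a, P i3 i1 = - tensl x, P i3 i2 = 0 & P i3 i3 = 0]].
Proof.
have trE : \tr (V2_mx x a : 'M_(1 + 1)) = tensl x - tensl (cconj x).
  by rewrite mxtrace_block !mxtrace_scalar !mulr1n.
have ul (i j : 'I_2) : P (lshift 2 i : 'I_4) (lshift 2 j : 'I_4) = 0.
  by rewrite [LHS](@block_mxEul _ 2 2 2 2) mxE.
have dr (i j : 'I_2) : P (rshift 2 i : 'I_4) (rshift 2 j : 'I_4) = 0.
  by rewrite [LHS](@block_mxEdr _ 2 2 2 2) mxE.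
have ur (i j : 'I_2) : P (lshift 2 i : 'I_4) (rshift 2 j : 'I_4) = V2_mx x a i j.
  by rewrite [LHS](@block_mxEur _ 2 2 2 2).
have dl (i j : 'I_2) : P (rshift 2 i : 'I_4) (lshift 2 j : 'I_4) =
    V2_mx x a i j - (if i == j then tensl x - tensl (cconj x) else 0).
  by rewrite [LHS](@block_mxEdl _ 2 2 2 2) !mxE trE; case: eqP.
have [v00 v01 v10 v11] := V2_mxE x a.
rewrite /i0 /i1 /i2 /i3 !ul !ur !dl !dr v00 v01 v10 v11 /= !subr0.
by rewrite subKr opprB addKr.
Qed.

Section Clifford.
Variables (x : 'rV[R]_(idim A').+1) (a : 'rV[R]_(idim A).+1).
Let P := G x a.

Lemma kmul_Gamma_l p (Z : kmx 4 p) j :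
  [/\ kmul P Z i0 j = tmul (tensl x) (Z i2 j) + tmul (tensr (cconj a)) (Z i3 j),
      kmul P Z i1 j = tmul (tensr a) (Z i2 j) - tmul (tensl (cconj x)) (Z i3 j),
      kmul P Z i2 j = tmul (tensl (cconj x)) (Z i0 j) + tmul (tensr (cconj a)) (Z i1 j) &
      kmul P Z i3 j = tmul (tensr a) (Z i0 j) - tmul (tensl x) (Z i1 j)].
Proof.
have [[e00 e01 e02 e03] [e10 e11 e12 e13] [e20 e21 e22 e23] [e30 e31 e32 e33]] :=
  GammaE x a.
by rewrite !mxE !sum4 /P e00 e01 e02 e03 e10 e11 e12 e13 e20 e21 e22 e23 e30 e31 e32 e33
  !tmul0l !tmulNl ?addr0 ?add0r.
Qed.

Lemma kmul_Gamma_r p (Z : kmx p 4) i :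
  [/\ kmul Z P i i0 = tmul (Z i i2) (tensl (cconj x)) + tmul (Z i i3) (tensr a),
      kmul Z P i i1 = tmul (Z i i2) (tensr (cconj a)) - tmul (Z i i3) (tensl x),
      kmul Z P i i2 = tmul (Z i i0) (tensl x) + tmul (Z i i1) (tensr a) &
      kmul Z P i i3 = tmul (Z i i0) (tensr (cconj a)) - tmul (Z i i1) (tensl (cconj x))].
Proof.
have [[e00 e01 e02 e03] [e10 e11 e12 e13] [e20 e21 e22 e23] [e30 e31 e32 e33]] :=
  GammaE x a.
by rewrite !mxE !sum4 /P e00 e01 e02 e03 e10 e11 e12 e13 e20 e21 e22 e23 e30 e31 e32 e33
  !tmul0r !tmulNr ?addr0 ?add0r.
Qed.

(** For instance the first row is A (A^* Z_0 + a^* Z_1) + a^* (a Z_0 - A Z_1):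
the terms in Z_1 cancel because A and a^* commute, and the composition laws
leave (|A|^2 + |a|^2) Z_0. *)
Lemma Gamma_sq_l p (Z : kmx 4 p) : kmul P (kmul P Z) = (N' x + N a) *: Z.
Proof.
apply/matrixP=> i j; rewrite [RHS]mxE.
have [E0 E1 E2 E3] := kmul_Gamma_l Z j; have [F0 F1 F2 F3] := kmul_Gamma_l (kmul P Z) j.
have C := (tmulDr, tmulNr, tensl_conjKl, conj_tenslKl, tensr_conjKl, conj_tensrKl, tens_lrC).
move: i; apply: ord4P; rewrite scalerDl.
- by rewrite F0 E2 E3 !C addrACA addrN addr0.
- by rewrite F1 E2 E3 !C opprB [LHS]addrC addrA subrK.
- by rewrite F2 E0 E1 !C addrACA addrN addr0.
- by rewrite F3 E0 E1 !C opprB [LHS]addrC addrA subrK.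
Qed.

Lemma Gamma_sq_r p (Z : kmx p 4) : kmul (kmul Z P) P = (N' x + N a) *: Z.
Proof.
apply/matrixP=> j i; rewrite [RHS]mxE.
have [E0 E1 E2 E3] := kmul_Gamma_r Z j; have [F0 F1 F2 F3] := kmul_Gamma_r (kmul Z P) j.
have C := (tmulDl, tmulNl, tensl_conjKr, conj_tenslKr, tensr_conjKr, conj_tensrKr, tens_rlC).
move: i; apply: ord4P; rewrite scalerDl.
- by rewrite F0 E2 E3 !C addrACA addrN addr0.
- by rewrite F1 E2 E3 !C opprB [LHS]addrC addrA subrK.
- by rewrite F2 E0 E1 !C addrACA addrN addr0.
- by rewrite F3 E0 E1 !C opprB [LHS]addrC addrA subrK.
Qed.

(** Also shows that det X is a multiple of the unit, so that reading off one
coordinate loses nothing. *)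
Lemma qform_Gamma : qform P = N' x + N a.
Proof.
have e0 : (0 : 'I_2) = j0 by apply: val_inj.
have e1 : (1 : 'I_2) = j1 by apply: val_inj.
have [v00 v01 v10 v11] := V2_mxE x a.
have -> : qform P = - det2 (V2_mx x a) 0 0.
  rewrite /qform; congr (- det2 _ 0 0); exact: (@block_mxKur _ 2 2 2 2).
rewrite /det2 e0 e1 v00 v01 v10 v11.
have one00 : tensor_one 0 0 = 1.
  by rewrite /tensor_one /Defs.pure trmx_delta mul_delta_mx mxE !eqxx.
rewrite tmulNr -(tmul1r (tensl (cconj x))) -(tmul1r (tensr a)).
rewrite conj_tenslKl tensr_conjKl -opprD -scalerDl.
have scaled c : (- (c *: tensor_one)) 0 0 = - c.
  by move: tensor_one one00 => u u00; rewrite !mxE u00 mulr1.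
by rewrite scaled opprK.
Qed.

End Clifford.

Lemma tensl_linear : linear tensl.
Proof. exact: pure_linear_l. Qed.

Lemma tensr_linear : linear tensr.
Proof. exact: pure_linear_r. Qed.

Lemma Gamma_linear : linear (fun u : _ * _ => G u.1 u.2).
Proof.
have entry r (M M' : kmx 4 4) i j : (r *: M + M') i j = r *: M i j + M' i j.
  by rewrite !mxE.
move=> r [x a] [y b] /=; apply/matrixP=> i j; rewrite entry.
move: (GammaE (r *: x + y) (r *: a + b)) (GammaE x a) (GammaE y b).
(* Only the entries matter from here on; opaque names for the matrices keep
   unification from unfolding them. *)
move: (G (r *: x + y) (r *: a + b)) (G x a) (G y b) => M0 M1 M2.
case=> [[e00 e01 e02 e03] [e10 e11 e12 e13] [e20 e21 e22 e23] [e30 e31 e32 e33]].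
case=> [[f00 f01 f02 f03] [f10 f11 f12 f13] [f20 f21 f22 f23] [f30 f31 f32 f33]].
case=> [[g00 g01 g02 g03] [g10 g11 g12 g13] [g20 g21 g22 g23] [g30 g31 g32 g33]].
have L := (cconjD cA, cconjZ cA, cconjD cA', cconjZ cA', tensl_linear, tensr_linear).
have NL u v : - (r *: u + v) = r *: - u - v :> tens by rewrite opprD scalerN.
move: i; apply: ord4P; move: j; apply: ord4P.
- by rewrite e00 f00 g00 scaler0 addr0.
- by rewrite e01 f01 g01 scaler0 addr0.
- by rewrite e02 f02 g02 L.
- by rewrite e03 f03 g03 !L.
- by rewrite e10 f10 g10 scaler0 addr0.
- by rewrite e11 f11 g11 scaler0 addr0.
- by rewrite e12 f12 g12 L.
- by rewrite e13 f13 g13 !L NL.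
- by rewrite e20 f20 g20 !L.
- by rewrite e21 f21 g21 !L.
- by rewrite e22 f22 g22 scaler0 addr0.
- by rewrite e23 f23 g23 scaler0 addr0.
- by rewrite e30 f30 g30 L.
- by rewrite e31 f31 g31 L NL.
- by rewrite e32 f32 g32 scaler0 addr0.
- by rewrite e33 f33 g33 scaler0 addr0.
Qed.

Lemma Gamma_inj x a y b : G x a = G y b -> x = y /\ a = b.
Proof.
move=> E; have := GammaE x a; rewrite E => -[[_ _ e02 _] [_ _ e12 _] _ _].
have [[_ _ f02 _] [_ _ f12 _] _ _] := GammaE y b.
have /matrixP X := etrans (esym e02) f02.
have /matrixP Y := etrans (esym e12) f12.
split; apply/rowP=> i.
  by have := X i 0; rewrite !mxE !big_ord1 !mxE !eqxx !mulr1.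
by have := Y 0 i; rewrite !mxE !big_ord1 !mxE !eqxx !mul1r.
Qed.

(** * The action on vectors *)

Notation V4 := (V4 A' A).
Implicit Types P Q : kmx 4 4.

Lemma mem_V4 P : P \in V4 <-> exists x a, P = G x a.
Proof.
apply: V4P => r u v; first by rewrite (cconjD cA') (cconjZ cA').
by rewrite (cconjD cA) (cconjZ cA).
Qed.

Lemma V4_sq_l P (Z : kmx 4 4) : P \in V4 -> kmul P (kmul P Z) = qform P *: Z.
Proof. by case/mem_V4=> x [a ->]; rewrite qform_Gamma Gamma_sq_l. Qed.

Lemma V4_sq_r P (Z : kmx 4 4) : P \in V4 -> kmul (kmul Z P) P = qform P *: Z.
Proof. by case/mem_V4=> x [a ->]; rewrite qform_Gamma Gamma_sq_r. Qed.

Definition polar P Q := qform (P + Q) - qform P - qform Q.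

Lemma kmulDl (P Q Z : kmx 4 4) : kmul (P + Q) Z = kmul P Z + kmul Q Z.
Proof. by have := kmul_linear_l Z 1 P Q; rewrite !scale1r. Qed.
Lemma kmulDr (Z P Q : kmx 4 4) : kmul Z (P + Q) = kmul Z P + kmul Z Q.
Proof. by have := kmul_linear Z 1 P Q; rewrite !scale1r. Qed.
Lemma kmulZl r (P Z : kmx 4 4) : kmul (r *: P) Z = r *: kmul P Z.
Proof. exact: (linear_on_scale (kmul_linear_l Z)). Qed.
Lemma kmulZr r (Z P : kmx 4 4) : kmul Z (r *: P) = r *: kmul Z P.
Proof. exact: (linear_on_scale (kmul_linear Z)). Qed.

Lemma kmulBl (P Q Z : kmx 4 4) : kmul (P - Q) Z = kmul P Z - kmul Q Z.
Proof. by rewrite kmulDl; congr (_ + _); rewrite -scaleN1r kmulZl scaleN1r. Qed.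

(** Polarization of [V4_sq_l].  Bracketing to the right, as P (Q Z), makes this an
identity between left multiplication operators. *)
Lemma clifford_relation P Q (Z : kmx 4 4) : P \in V4 -> Q \in V4 ->
  kmul P (kmul Q Z) + kmul Q (kmul P Z) = polar P Q *: Z.
Proof.
move=> VP VQ; have := V4_sq_l Z (rpredD VP VQ).
rewrite !(kmulDl, kmulDr) !V4_sq_l // /polar !scalerBl => <-.
have cancel (u v s t : kmx 4 4) : s + t = (u + s) + (t + v) - u - v.
  by rewrite addrA [_ + v - u]addrAC addrK [_ - u]addrC -(addrA u) addKr.
exact: cancel.
Qed.

Lemma kmul_anticomm P Q : P \in V4 -> Q \in V4 ->
  kmul P Q = polar P Q *: kmx_one 4 - kmul Q P.
Proof.
by move=> VP VQ; rewrite -clifford_relation // !kmul1r addrK.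
Qed.

(** (P Q) P = beta(P, Q) P - (Q P) P = beta(P, Q) P - q(P) Q by the Clifford
relation at the identity matrix and the right square law. *)
Lemma kconjE P Q : P \in V4 -> Q \in V4 -> qform P != 0 ->
  kconj P Q = (polar P Q / qform P) *: P - Q.
Proof.
move=> VP VQ nzP; rewrite /kconj /kinv kmulZr (kmul_anticomm VP VQ).
rewrite kmulBl !kmulZl kmul1l V4_sq_r // scalerBr !scalerA mulrC.
by rewrite mulVf // scale1r.
Qed.

Lemma kconj_V4 P Q : P \in V4 -> Q \in V4 -> qform P != 0 -> kconj P Q \in V4.
Proof. by move=> VP VQ nzP; rewrite kconjE // rpredB ?rpredZ. Qed.

(** The Clifford-algebra form of the conjugation, L_P L_Q = L_{P Q P^-1} L_P,
which holds for left multiplication operators although matrix multiplication is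
not associative. *)
Lemma kmul_kconj P Q (Z : kmx 4 4) : P \in V4 -> Q \in V4 -> qform P != 0 ->
  kmul P (kmul Q Z) = kmul (kconj P Q) (kmul P Z).
Proof.
move=> VP VQ nzP; rewrite kconjE // kmulBl !kmulZl V4_sq_l //.
by rewrite scalerA divfK // -clifford_relation // addrK.
Qed.

(** The action of P_1 . P_2 is determined by the operator c = L_{P_1} L_{P_2}:
both sides, as left multiplications, equal c L_Q c^-1. *)
Lemma kconj_pair_eq P1 P2 P1' P2' Q :
  [/\ P1 \in V4, P2 \in V4, P1' \in V4 & P2' \in V4] ->
  [/\ qform P1 != 0, qform P2 != 0, qform P1' != 0 & qform P2' != 0] ->
  (lmul P1 \o lmul P2 = lmul P1' \o lmul P2')%VF -> Q \in V4 ->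
  kconj P1 (kconj P2 Q) = kconj P1' (kconj P2' Q).
Proof.
move=> [V1 V2 V1' V2'] [nz1 nz2 nz1' nz2'] E VQ.
have {}E (Z : kmx 4 4) : kmul P1 (kmul P2 Z) = kmul P1' (kmul P2' Z).
  by have /lfunP/(_ Z) := E; rewrite !comp_lfunE !lmulE.
have V3 := kconj_V4 V2 VQ nz2; have V3' := kconj_V4 V2' VQ nz2'.
have D (Z : kmx 4 4) : kmul (kconj P1 (kconj P2 Q)) (kmul P1 (kmul P2 Z)) =
           kmul (kconj P1' (kconj P2' Q)) (kmul P1 (kmul P2 Z)).
  rewrite [in RHS]E -(kmul_kconj _ V1 V3 nz1) -(kmul_kconj _ V2 VQ nz2) E.
  by rewrite -(kmul_kconj _ V1' V3' nz1') -(kmul_kconj _ V2' VQ nz2').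
(* This argument is c^-1 of the identity matrix, up to a nonzero scalar. *)
have := D (kmul P2 (kmul P1 (kmx_one 4))).
rewrite !V4_sq_l // !kmulZr !V4_sq_l // !kmulZr !kmul1r.
by move/(scalerI nz2)/(scalerI nz1).
Qed.

(** A product of two vectors lies in the Clifford algebra by definition. *)
Lemma second_orderP c : second_order (A' := A') (A := A) c <->
  exists P1 P2, [/\ unit_vector P1, unit_vector P2 & c = (lmul P1 \o lmul P2)%VF].
Proof.
split=> [[]//|[P1 [P2 [u1 u2 ->]]]]; split; last by exists P1, P2.
by move=> S _ SM SV; apply: SM; apply: SV; [case: u1|case: u2].
Qed.

End Tensor.

(** * Matrices of endomorphisms *)

Section EndMatrix.
Variables (K : fieldType) (V : vectType K).

Lemma coord_dual n (b : n.-tuple V) (i j : 'I_n) : basis_of fullv b ->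
  coord b i b`_j = (i == j)%:R.
Proof. by move=> bb; rewrite coord_free ?(basis_free bb) // eq_sym. Qed.

(** Two bases are needed to express a change of basis as the matrix of the
identity. *)
Definition mx_of_hom n m (b : n.-tuple V) (c : m.-tuple V) (f : 'End(V)) :
    'M[K]_(n, m) := \matrix_(i, j) coord b i (f c`_j).

Lemma mx_of_hom_comp n m p (b : n.-tuple V) (c : m.-tuple V) (d : p.-tuple V) f g :
  basis_of fullv c ->
  mx_of_hom b d (f \o g)%VF = mx_of_hom b c f *m mx_of_hom c d g.
Proof.
move=> bc; apply/matrixP=> i j; rewrite !mxE comp_lfunE.
rewrite {1}(coord_basis bc (memvf (g d`_j))) !linear_sum.
by apply: eq_bigr => k _; rewrite !linearZ /= !mxE mulrC.
Qed.

Lemma mx_of_end_comp n (b : n.-tuple V) f g : basis_of fullv b ->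
  mx_of_end b (f \o g)%VF = mx_of_end b f *m mx_of_end b g.
Proof. exact: mx_of_hom_comp. Qed.

Lemma mx_of_end_id n (b : n.-tuple V) : basis_of fullv b ->
  mx_of_end b \1%VF = 1%:M.
Proof.
by move=> bb; apply/matrixP=> i j; rewrite !mxE id_lfunE coord_dual.
Qed.

(** Conjugation by the change of basis.  The two lengths agree only
propositionally, since [vbasis] has length the dimension of the space. *)
Lemma det_mx_of_end n m (b : n.-tuple V) (c : m.-tuple V) f :
  basis_of fullv b -> basis_of fullv c ->
  \det (mx_of_end b f) = \det (mx_of_end c f).
Proof.
move=> bb bc; have E : n = m by rewrite -(size_basis bb) (size_basis bc).
move: c bc; rewrite -E => c bc.
pose S := mx_of_hom b c \1%VF; pose T := mx_of_hom c b \1%VF.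
have ST : S *m T = 1%:M by rewrite -mx_of_hom_comp // comp_lfun1l; apply: mx_of_end_id.
have -> : mx_of_end b f = S *m mx_of_end c f *m T.
  rewrite -[mx_of_end c f]/(mx_of_hom c c f).
  by rewrite -!mx_of_hom_comp // comp_lfun1l comp_lfun1r.
by rewrite !det_mulmx mulrAC -det_mulmx ST det1 mul1r.
Qed.

Lemma mx_of_end_inj n (b : n.-tuple V) f g : basis_of fullv b ->
  mx_of_end b f = mx_of_end b g -> f = g.
Proof.
move=> bb /matrixP E; apply/lfunP=> v.
rewrite [v](coord_basis bb (memvf _)) !linear_sum; apply: eq_bigr => j _.
rewrite !linearZ /=; congr (_ *: _).
rewrite [f _](coord_basis bb (memvf _)) [RHS](coord_basis bb (memvf _)).
by apply: eq_bigr => i _; have := E i j; rewrite !mxE => ->.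
Qed.

Lemma mx_of_end_surj n (b : n.-tuple V) (M : 'M_n) : basis_of fullv b ->
  exists f, mx_of_end b f = M.
Proof.
move=> bb; pose F v := \sum_i (\sum_j M i j * coord b j v) *: b`_i.
have lF : linear F.
  move=> a u v; rewrite /F scaler_sumr -big_split; apply: eq_bigr => i _ /=.
  rewrite scalerA -scalerDl mulr_sumr -big_split; congr (_ *: _).
  by apply: eq_bigr => j _; rewrite linearP /= mulrDr mulrCA.
exists (linfun F); apply/matrixP=> i j.
rewrite mxE linfunE // coord_sum_free ?(basis_free bb) //.
rewrite (bigD1 j) //= coord_dual // eqxx mulr1 big1 ?addr0 // => k ne.
by rewrite coord_dual // (negbTE ne) mulr0.
Qed.

End EndMatrix.

(** Compare two block triangularizations of the bordered matrix
(1, u; v, 1). *)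
Lemma det_sub_rank1 (K : comNzRingType) n (u : 'cV[K]_n) (v : 'rV[K]_n) :
  \det (1%:M - u *m v) = 1 - (v *m u) 0 0.
Proof.
have E : block_mx 1%:M u v 1%:M *m block_mx 1%:M 0 (- v) 1%:M =
    block_mx (1%:M - u *m v) u 0 1%:M.
  by rewrite mulmx_block !mulmx1 !mul1mx !mulmx0 mulmxN !add0r addrN.
have F : block_mx 1%:M 0 v 1%:M *m block_mx 1%:M u 0 (1%:M - v *m u) =
    block_mx 1%:M u v 1%:M.
  by rewrite mulmx_block !mulmx1 !mul1mx !mulmx0 mul0mx !addr0 addrCA addrN addr0.
have := congr1 determinant E; rewrite det_mulmx -F det_mulmx.
rewrite !det_ublock !det_lblock !det1 !mul1r !mulr1 => <-.
by rewrite det_mx11 !mxE eqxx.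
Qed.

(** * Reflections generate the orthogonal group *)

Section Orthogonal.
Variables (R : rcfType) (V : vectType R) (n : nat) (b : n.-tuple V).
Variable eps : 'I_n -> R.
Hypotheses (bb : basis_of fullv b) (eps_unit : forall i, eps i = 1 \/ eps i = -1).
Implicit Types (u v w : V) (f g : 'End(V)).

Definition bform u v := \sum_i eps i * (coord b i u * coord b i v).
Notation B := bform.
Definition bsq v := B v v.
Notation q := bsq.

Lemma bformC u v : B u v = B v u.
Proof. by apply: eq_bigr => i _; rewrite [coord _ _ u * _]mulrC. Qed.

Lemma bformPl a u v w : B (a *: u + v) w = a * B u w + B v w.
Proof.
rewrite mulr_sumr -big_split; apply: eq_bigr => i _; rewrite linearP /=; ring.
Qed.

Lemma bformDl u v w : B (u + v) w = B u w + B v w.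
Proof. by rewrite -[u]scale1r bformPl mul1r scale1r. Qed.

Lemma bformZl a u w : B (a *: u) w = a * B u w.
Proof. by rewrite mulr_sumr; apply: eq_bigr => i _; rewrite linearZ /=; ring. Qed.

Lemma bformBl u v w : B (u - v) w = B u w - B v w.
Proof. by rewrite bformDl -scaleN1r bformZl mulN1r. Qed.

Lemma bformDr u v w : B w (u + v) = B w u + B w v.
Proof. by rewrite bformC bformDl !(bformC w). Qed.

Lemma bformZr a u w : B w (a *: u) = a * B w u.
Proof. by rewrite bformC bformZl (bformC w). Qed.

Lemma bformBr u v w : B w (u - v) = B w u - B w v.
Proof. by rewrite bformC bformBl !(bformC w). Qed.

Lemma bsqN v : q (- v) = q v.
Proof. by rewrite -scaleN1r /bsq bformZl bformZr !mulN1r opprK. Qed.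

Lemma bform_basis (i j : 'I_n) : B b`_i b`_j = eps i *+ (i == j).
Proof.
rewrite /bform (bigD1 i) //= big1 => [|k ne]; rewrite !coord_dual //.
  by rewrite eqxx mul1r addr0 mulr_natr.
by rewrite (negbTE ne) mul0r mulr0.
Qed.

Definition refl v : 'End(V) := linfun (fun u => u - (2 * B u v / q v) *: v).

Lemma reflE v u : refl v u = u - (2 * B u v / q v) *: v.
Proof.
apply: (linfunE (f := fun u => u - (2 * B u v / q v) *: v)) => a x y.
rewrite bformPl scalerBr [RHS]addrACA; congr (_ + _).
by rewrite -opprD; congr (- _); rewrite scalerA -scalerDl; congr (_ *: _); ring.
Qed.

Definition isometry f := forall v, q (f v) = q v.

(** Polarization, as 2 is invertible. *)
Lemma isometry_bform f u v : isometry f -> B (f u) (f v) = B u v.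
Proof.
move=> If; have two : (2 : R) != 0 by rewrite pnatr_eq0.
apply: (mulfI two); have := If (u + v); rewrite linearD /bsq !(bformDl, bformDr).
have := If u; have := If v; rewrite /bsq => -> ->.
rewrite (bformC (f v)) (bformC v) => /(congr1 (fun x => x - B u u - B v v)).
by move=> E; transitivity (B u u + B (f u) (f v) + (B (f u) (f v) + B v v) - B u u - B v v);
  [ring|rewrite E; ring].
Qed.

Lemma refl_isometry v : q v != 0 -> isometry (refl v).
Proof.
move=> nz u; rewrite reflE /bsq !(bformBl, bformBr, bformZl, bformZr) (bformC v).
by rewrite -!/(bsq _); field.
Qed.

Lemma reflK v : q v != 0 -> (refl v \o refl v)%VF = \1%VF.
Proof.
move=> nz; apply/lfunP=> u; rewrite comp_lfunE id_lfunE [refl v u]reflE reflE.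
rewrite bformBl bformZl -/(q v) -addrA -opprD -scalerDl.
have -> : 2 * B u v / q v + 2 * (B u v - 2 * B u v / q v * q v) / q v = 0 by field.
by rewrite scale0r subr0.
Qed.

Lemma refl_scale c v : c != 0 -> q v != 0 -> refl (c *: v) = refl v.
Proof.
move=> nzc nz; apply/lfunP=> u; rewrite !reflE /bsq bformZl !bformZr scalerA -/(q v).
by congr (_ - (_ *: _)); field; rewrite nz nzc.
Qed.

(** The matrix of [refl v] is 1 minus a rank-one matrix of trace 2. *)
Lemma det_refl v : q v != 0 -> \det (mx_of_end b (refl v)) = -1.
Proof.
move=> nz.
have -> : mx_of_end b (refl v) = 1%:M -
    (\col_i coord b i v) *m (\row_j (2 * (eps j * coord b j v) / q v)).
  apply/matrixP=> i j; rewrite !mxE big_ord1 !mxE reflE linearB linearZ /=.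
  rewrite coord_dual //; congr (_ - _).
  rewrite mulrC; congr (_ * (_ / _)); congr (_ * _).
  rewrite /bform (bigD1 j) //= big1 => [|k ne]; rewrite coord_dual //.
    by rewrite eqxx mul1r addr0.
  by rewrite (negbTE ne) mul0r mulr0.
rewrite det_sub_rank1 mxE (eq_bigr (fun j => 2 / q v * (eps j * (coord b j v * coord b j v)))).
  by rewrite -mulr_sumr -/(B v v) -/(q v) divfK //; ring.
by move=> j _; rewrite !mxE; ring.
Qed.

Definition refl_prod (vs : seq V) : 'End(V) :=
  foldr (fun v g => (refl v \o g)%VF) \1%VF vs.

Lemma refl_prod_cat s t : refl_prod (s ++ t) = (refl_prod s \o refl_prod t)%VF.
Proof.
by elim: s => [|v s IH] /=; rewrite ?comp_lfun1l // IH comp_lfunA.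
Qed.

Lemma det_refl_prod vs : all (fun v => q v != 0) vs ->
  \det (mx_of_end b (refl_prod vs)) = (-1) ^+ size vs.
Proof.
elim: vs => [|v vs IH] /=; first by rewrite mx_of_end_id // det1.
by case/andP=> nz /IH E; rewrite mx_of_end_comp // det_mulmx det_refl // E exprS.
Qed.

(** B(u, u - v) is half of q(u - v) when q(u) = q(v). *)
Lemma refl_swap u v : q u = q v -> q (u - v) != 0 -> refl (u - v) u = v.
Proof.
move=> E nz; rewrite reflE.
have -> : 2 * B u (u - v) = q (u - v).
  by rewrite /bsq !(bformBl, bformBr) -!/(q _) E (bformC v); ring.
by rewrite divff // scale1r opprB addrC subrK.
Qed.

Lemma refl_orth u v : B u v = 0 -> refl v u = u.
Proof. by move=> E; rewrite reflE E mulr0 mul0r scale0r subr0. Qed.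

Lemma refl_selfN v : q v != 0 -> refl v (- v) = v.
Proof.
move=> nz; rewrite linearN /= reflE -/(q v) mulfK // scaler_nat mulr2n.
by rewrite opprB addrK.
Qed.

Lemma q_basis_neq0 (i : 'I_n) : q b`_i != 0.
Proof.
rewrite /bsq bform_basis eqxx mulr1n.
by case: (eps_unit i) => ->; rewrite ?oppr_eq0 oner_eq0.
Qed.

Lemma isometry_comp f g : isometry f -> isometry g -> isometry (f \o g)%VF.
Proof. by move=> If Ig v; rewrite comp_lfunE If Ig. Qed.

Lemma refl_prod_isometry vs : all (fun v => q v != 0) vs -> isometry (refl_prod vs).
Proof.
elim: vs => [|v vs IH] /=; first by move=> _ u; rewrite id_lfunE.
by case/andP=> nz /IH; apply: isometry_comp; apply: refl_isometry.
Qed.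

Lemma refl_prod_rev vs : all (fun v => q v != 0) vs ->
  (refl_prod (rev vs) \o refl_prod vs)%VF = \1%VF.
Proof.
elim: vs => [|v vs IH] /=; first by rewrite comp_lfun1l.
case/andP=> nz /IH E; rewrite rev_cons -cats1 refl_prod_cat /= comp_lfun1r.
by rewrite comp_lfunA -(comp_lfunA _ (refl v) (refl v)) reflK // comp_lfun1r.
Qed.

(** Descending induction on the number of leading basis vectors that f fixes.
Let e be the first other basis vector and w = f e, so that q(w) = q(e).  As
q(w - e) + q(w + e) = 4 q(e) is nonzero, one of w - e, w + e is anisotropic.  In
the first case the reflection in w - e sends w to e; in the second the
reflection in w + e sends w to - e, and the one in e sends - e to e.  All these
reflections fix the earlier basis vectors, which are orthogonal to both e and
w. *)
Lemma cartan_dieudonne_aux m f : isometry f ->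
  (forall i : 'I_n, (i < n - m)%N -> f b`_i = b`_i) ->
  exists2 vs, all (fun v => q v != 0) vs & f = refl_prod vs.
Proof.
elim: m f => [|m IH] f If fix_f.
  exists [::] => //=; apply/lfunP=> v; rewrite id_lfunE.
  rewrite {2}[v](coord_basis bb (memvf _)) [v in LHS](coord_basis bb (memvf _)) linear_sum.
  by apply: eq_bigr => i _; rewrite linearZ /= fix_f // subn0.
have [le_nm|lt_mn] := leqP n m.
  by apply: IH => // i; rewrite (eqP le_nm) ltn0.
have lt_k : (n - m.+1 < n)%N by rewrite ltn_subrL (leq_trans _ lt_mn).
pose k := Ordinal lt_k; pose e := b`_k; pose w := f e.
have ltS (i : 'I_n) : (i < n - m)%N -> (i < k)%N \/ i = k.
  by rewrite -(subnSK lt_mn) ltnS leq_eqVlt => /orP[/eqP E|]; [right; apply: val_inj|left].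
(* It suffices to find reflections [rs] that send w to e and fix the earlier
   basis vectors: the induction applies to their composite with f. *)
have extend rs : all (fun v => q v != 0) rs -> refl_prod rs w = e ->
    (forall i : 'I_n, (i < k)%N -> all (fun v => B b`_i v == 0) rs) ->
    exists2 vs, all (fun v => q v != 0) vs & f = refl_prod vs.
  move=> nz_rs rs_w rs_orth.
  have fix_rs u : all (fun v => B u v == 0) rs -> refl_prod rs u = u.
    elim: rs {nz_rs rs_w rs_orth} => [|v rs IHrs] /=; first by rewrite id_lfunE.
    by case/andP=> /eqP Buv /IHrs E; rewrite comp_lfunE E refl_orth.
  have [|i lt_i|vs nz_vs E] := IH (refl_prod rs \o f)%VF.
  - by apply: isometry_comp If; apply: refl_prod_isometry.
  - rewrite comp_lfunE; have [lt_ik|->] := ltS i lt_i; last exact: rs_w.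
    by rewrite fix_f ?fix_rs ?rs_orth.
  exists (rev rs ++ vs); first by rewrite all_cat all_rev nz_rs.
  by rewrite refl_prod_cat -E comp_lfunA refl_prod_rev // comp_lfun1l.
have qw : q w = q e by apply: If.
have nz_e : q e != 0 by apply: q_basis_neq0.
have orth_e (i : 'I_n) : (i < k)%N -> B b`_i e = 0.
  by move=> lt_ik; rewrite bform_basis -val_eqE (ltn_eqF lt_ik).
have orth_w (i : 'I_n) : (i < k)%N -> B b`_i w = 0.
  move=> lt_ik; have fi : f b`_i = b`_i by apply: fix_f.
  by rewrite /w -fi isometry_bform // orth_e.
have [q0|nz] := eqVneq (q (w - e)) 0; last first.
  apply: (extend [:: w - e]) => [|/=|i lt_ik] /=; first by rewrite nz.
    by rewrite comp_lfunE id_lfunE refl_swap.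
  by rewrite bformBr orth_e // orth_w // subrr eqxx.
have nz : q (w - - e) != 0.
  have -> : q (w - - e) = 4 * q e - q (w - e).
    rewrite {1 3}/bsq opprK !(bformBl, bformBr, bformDl, bformDr).
    by rewrite -!/(q _) qw; ring.
  by rewrite q0 subr0 mulf_neq0 // pnatr_eq0.
apply: (extend [:: e; w - - e]) => [|/=|i lt_ik] /=; first by rewrite nz nz_e.
  have qwN : q w = q (- e) by rewrite bsqN.
  by rewrite !comp_lfunE id_lfunE (refl_swap qwN nz) refl_selfN.
by rewrite opprK bformDr !orth_e // orth_w // addr0 eqxx.
Qed.

Lemma cartan_dieudonne f : isometry f ->
  exists2 vs, all (fun v => q v != 0) vs & f = refl_prod vs.
Proof.
move=> If; apply: (@cartan_dieudonne_aux n) => // i; by rewrite subnn ltn0.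
Qed.

Definition unit_norm v := q v = 1 \/ q v = -1.

Lemma unit_norm_neq0 v : unit_norm v -> q v != 0.
Proof. by case=> ->; rewrite ?oppr_eq0 oner_eq0. Qed.

(** The only place where square roots of positive scalars are used. *)
Lemma refl_normalize v : q v != 0 -> exists2 u, unit_norm u & refl u = refl v.
Proof.
move=> nz; pose c := (Num.sqrt `|q v|)^-1.
have c2 : c * c = `|q v|^-1 by rewrite -invfM -expr2 sqr_sqrtr.
have nzc : c != 0 by rewrite invr_neq0 // sqrtr_eq0 -ltNge normr_gt0.
exists (c *: v); last exact: refl_scale.
rewrite /unit_norm /bsq bformZl bformZr mulrA c2 -/(q v).
have [ge0|lt0] := leP 0 (q v).
  by left; rewrite ger0_norm // mulVf.
by right; rewrite ltr0_norm // invrN mulNr mulVf.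
Qed.

Definition rotation f := exists u v, [/\ unit_norm u, unit_norm v & f = (refl u \o refl v)%VF].

Lemma even_refl_prod_generated m vs : all (fun v => q v != 0) vs ->
  size vs = m.*2 -> generated rotation (refl_prod vs).
Proof.
elim: m vs => [|m IH] [|v [|w vs]] //= => [_ _|/and3P[nzv nzw nz] [sz]].
  exact: gen_id.
rewrite comp_lfunA; apply: gen_comp; last exact: IH.
have [v' uv <-] := refl_normalize nzv; have [w' uw <-] := refl_normalize nzw.
by apply: gen_in; exists v', w'.
Qed.

Lemma SO_ofP f : SO_of q f <-> isometry f /\ \det (mx_of_end b f) = 1.
Proof.
by rewrite /SO_of (det_mx_of_end _ (vbasisP _) bb).
Qed.

Lemma SO_generated_rotations f : generated rotation f <-> SO_of q f.
Proof.
split=> [|/SO_ofP[If df]].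
  elim=> {f} [f [u [v [uu uv ->]]]||f g _ /SO_ofP[If df] _ /SO_ofP[Ig dg]|
              f g _ /SO_ofP[If df] fg _]; apply/SO_ofP.
  - have nzu := unit_norm_neq0 uu; have nzv := unit_norm_neq0 uv.
    split; first by apply: isometry_comp; apply: refl_isometry.
    by rewrite mx_of_end_comp // det_mulmx !det_refl // mulrNN mulr1.
  - by split=> [v|]; rewrite ?id_lfunE // mx_of_end_id // det1.
  - by split; [apply: isometry_comp|rewrite mx_of_end_comp // det_mulmx df dg mulr1].
  - split=> [v|]; first by rewrite -If -comp_lfunE fg id_lfunE.
    have := congr1 (fun h => \det (mx_of_end b h)) fg.
    by rewrite /= mx_of_end_comp // mx_of_end_id // det1 det_mulmx df mul1r.
have [vs nz E] := cartan_dieudonne If.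
move: df; rewrite E det_refl_prod // -signr_odd.
case ev: (odd (size vs)).
  by move/eqP; rewrite expr1 eq_sym -subr_eq0 opprK -mulr2n pnatr_eq0.
move=> _; apply: (@even_refl_prod_generated (size vs)./2) => //.
by rewrite -[LHS]odd_double_half ev.
Qed.

Definition gram : 'M[R]_n := \matrix_(i, j) (eps i *+ (i == j)).

(** The entries of the matrix on the left are the values of B on the images of
the basis vectors. *)
Lemma isometryP f : isometry f <->
  (mx_of_end b f)^T *m gram *m mx_of_end b f = gram.
Proof.
have entry (i j : 'I_n) : ((mx_of_end b f)^T *m gram *m mx_of_end b f) i j =
    B (f b`_i) (f b`_j).
  rewrite mxE; apply: eq_bigr => k _; rewrite !mxE (bigD1 k) //= big1 => [|l ne].
    by rewrite !mxE eqxx mulr1n addr0; ring.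
  by rewrite !mxE (negbTE ne) mulr0n mulr0.
split=> [If|/matrixP E v].
  by apply/matrixP=> i j; rewrite entry isometry_bform // bform_basis !mxE.
have EB (i j : 'I_n) : B (f b`_i) (f b`_j) = B b`_i b`_j by rewrite -entry E bform_basis mxE.
have sumB (g : 'End(V)) : q (g v) =
    \sum_i \sum_j coord b i v * coord b j v * B (g b`_i) (g b`_j).
  have suml (F : 'I_n -> V) u : B (\sum_i F i) u = \sum_i B (F i) u.
    elim/big_rec2: _ => [|i y1 y2 _ <-]; last by rewrite bformDl.
    by rewrite /bform big1 // => k _; rewrite linear0 mul0r mulr0.
  rewrite /bsq {1 2}[v](coord_basis bb (memvf _)) !linear_sum suml.
  apply: eq_bigr => i _; rewrite bformC suml; apply: eq_bigr => j _.
  by rewrite !linearZ /= bformZl bformC bformZl mulrCA mulrA.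
have := sumB \1%VF; rewrite id_lfunE sumB => ->.
by apply: eq_bigr => i _; apply: eq_bigr => j _; rewrite !id_lfunE EB.
Qed.

Lemma SO_group_iso : group_iso (fun f g => f \o g)%VF (fun M N : 'M[R]_n => M *m N)
  (SO_of q) (fun M => M^T *m gram *m M = gram /\ \det M = 1) (mx_of_end b).
Proof.
split=> [f /SO_ofP[If df]|f g _ _|f g _ _|M [EM dM]].
- by split=> //; apply/isometryP.
- exact: mx_of_end_comp.
- exact: mx_of_end_inj.
have [f Ef] := mx_of_end_surj M bb.
by exists f => //; apply/SO_ofP; split; [apply/isometryP; rewrite Ef|rewrite Ef].
Qed.

End Orthogonal.

(** * The vector representation *)

Definition signature_sign (R : nzRingType) p n (i : 'I_n) : R :=
  if (i < p)%N then 1 else -1.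

Lemma generated_mono (K : fieldType) (V : vectType K) (S T : 'End(V) -> Prop) f :
  (forall g, S g -> T g) -> generated S f -> generated T f.
Proof.
move=> sub; elim=> {f} [f /sub|||]; [exact: gen_in|exact: gen_id|..].
  by move=> f g _ + _; apply: gen_comp.
by move=> f g _; apply: gen_inv.
Qed.

Lemma SO_of_ext (K : fieldType) (V : vectType K) (q q' : V -> K) f :
  q =1 q' -> SO_of q f -> SO_of q' f.
Proof. by move=> E [If df]; split=> // v; rewrite -!E. Qed.

Lemma gram_signature (R : rcfType) p q :
  gram (signature_sign R p (n := p + q)) = block_mx 1%:M 0 0 (- 1%:M).
Proof.
apply/matrixP=> i j; rewrite mxE /signature_sign.
have [i' ->|i' ->] := split_ordP i; have [j' ->|j' ->] := split_ordP j.
- by rewrite block_mxEul mxE (inj_eq (@lshift_inj _ _)).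
- by rewrite block_mxEur mxE eq_lrshift mulr0n.
- by rewrite block_mxEdl mxE eq_rlshift mulr0n.
by rewrite block_mxEdr !mxE (inj_eq (@rshift_inj _ _)) mulNrn.
Qed.

Section VectorRepresentation.
Variables (R : rcfType) (A' A : calgebra R) (p' : nat).
Hypotheses (cA' : composition (A := A') (@signed_sq _ p' _))
  (cA : composition (A := A) (@sum_sq _ _)).
Notation V4 := (V4 A' A).
Notation W := (subvs_of V4).
Notation m := (idim A).+1.
Notation m' := (idim A').+1.
Notation G x a := (Gamma (@V2_mx R A' A x a)).

Lemma Gamma_V4 x a : G x a \in V4.
Proof. by apply/(mem_V4 cA' cA); exists x, a. Qed.

(** The first m vectors are the Gamma(0, a) with a a basis vector of K, the
others the Gamma(x, 0) with x a basis vector of K'.  In this order the positive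
vectors come first, since those of K' precede its negative ones. *)
Definition std_vector (l : 'I_(m + m')) : W :=
  vsproj V4 (G (\row_i (l == rshift m i)%:R) (\row_j (l == lshift m' j)%:R)).

Lemma std_combination (c : 'I_(m + m') -> R) :
  vsval (\sum_l c l *: std_vector l) =
  G (\row_i c (rshift m i)) (\row_j c (lshift m' j)).
Proof.
have pick (F : 'I_(m + m') -> R) l0 : \sum_l F l * (l == l0)%:R = F l0.
  rewrite (bigD1 l0) //= eqxx mulr1 big1 ?addr0 // => l /negbTE->; exact: mulr0.
have lG := Gamma_linear cA' cA.
pose u l : 'rV[R]_m' * 'rV[R]_m :=
  (\row_i (l == rshift m i)%:R, \row_j (l == lshift m' j)%:R).
rewrite linear_sum -[RHS]/((fun u : 'rV[R]_m' * 'rV[R]_m => G u.1 u.2) (_, _)).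
have sum1 (F : 'I_(m + m') -> 'rV[R]_m' * 'rV[R]_m) :
    (\sum_l F l).1 = \sum_l (F l).1 by apply: (big_morph fst).
have sum2 (F : 'I_(m + m') -> 'rV[R]_m' * 'rV[R]_m) :
    (\sum_l F l).2 = \sum_l (F l).2 by apply: (big_morph snd).
have -> : (\row_i c (rshift m i), \row_j c (lshift m' j)) = \sum_l c l *: u l.
  apply: injective_projections; rewrite ?sum1 ?sum2; apply/rowP=> i;
    rewrite mxE summxE -[LHS]pick; by apply: eq_bigr => l _; rewrite !mxE.
rewrite (linear_on_sum lG); apply: eq_bigr => l _.
by rewrite (linear_on_scale lG) linearZ /= vsprojK ?Gamma_V4.
Qed.

Definition std_basis : (m + m').-tuple W := [tuple std_vector l | l < m + m'].

Lemma std_basisP : basis_of fullv std_basis.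
Proof.
have nthE (c : 'I_(m + m') -> R) :
    \sum_l c l *: std_basis`_l = \sum_l c l *: std_vector l.
  by apply: eq_bigr => l _; rewrite -tnth_nth tnth_mktuple.
rewrite /basis_of eqEsubv subvf /=; apply/andP; split.
  apply/subvP=> v _.
  have /(mem_V4 cA' cA)[x [a E]] := valP v.
  pose c (l : 'I_(m + m')) := match split l with inl j => a 0 j | inr i => x 0 i end.
  have -> : v = \sum_l c l *: std_vector l.
    apply: val_inj; rewrite /= std_combination E.
    have -> : \row_i c (rshift m i) = x.
      by apply/rowP=> i; rewrite mxE /c (unsplitK (inr i)).
    have -> : \row_j c (lshift m' j) = a.
      by apply/rowP=> j; rewrite mxE /c (unsplitK (inl j)).
    by [].
  by rewrite -nthE; apply: memv_suml => l _; apply/memvZ/memv_span/mem_nth; rewrite size_tuple.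
apply/(@freeP _ _ _ std_basis)=> c E.
have /(congr1 vsval) := etrans (esym (nthE c)) E.
rewrite std_combination.
have -> : vsval (0 : W) = G 0 0.
  have := linear_on_scale (Gamma_linear cA' cA) 0 (0, 0).
  by rewrite scaler0 !scale0r => ->.
case/(Gamma_inj) => /rowP x0 /rowP a0 l.
by have [j ->|i ->] := split_ordP l; [have := a0 j|have := x0 i]; rewrite !mxE.
Qed.

Notation b := std_basis.
Notation eps := (signature_sign R (m + p') (n := m + m')).
Let q := (bsq b eps).

Lemma eps_unit l : eps l = 1 \/ eps l = -1.
Proof. by rewrite /signature_sign; case: ifP; [left|right]. Qed.

Lemma qform_std v : qform (vsval v) = q v.
Proof.
have b_v : v = \sum_l coord b l v *: std_vector l.
  rewrite {1}[v](coord_basis std_basisP (memvf _)).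
  by apply: eq_bigr => l _; rewrite -tnth_nth tnth_mktuple.
rewrite {1}b_v std_combination (qform_Gamma cA' cA) addrC.
rewrite /q /bsq /bform big_split_ord /sum_sq /signed_sq /=; congr (_ + _).
  by apply: eq_bigr => j _; rewrite mxE /signature_sign /= ltn_addr // mul1r expr2.
by apply: eq_bigr => i _; rewrite mxE /signature_sign /= ltn_add2l expr2.
Qed.

Let bb := std_basisP.

Let valD (u v : W) : vsval (u + v) = vsval u + vsval v. Proof. exact: linearD. Qed.
Let valB (u v : W) : vsval (u - v) = vsval u - vsval v. Proof. exact: linearB. Qed.
Let valN (u : W) : vsval (- u) = - vsval u. Proof. exact: linearN. Qed.
Let valZ c (u : W) : vsval (c *: u) = c *: vsval u. Proof. exact: linearZ. Qed.

Lemma polar_std u v : polar (vsval u) (vsval v) = 2 * bform b eps u v.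
Proof.
have qD : qform (vsval u + vsval v) = q (u + v) by rewrite -qform_std valD.
rewrite /polar qD !qform_std /q /bsq !(bformDl, bformDr) (bformC _ _ v); ring.
Qed.

Lemma kconj_refl u v : q u != 0 ->
  kconj (vsval u) (vsval v) = - vsval (refl b eps u v).
Proof.
move=> nz; rewrite (kconjE cA' cA) ?subvsP ?qform_std // polar_std reflE //.
by rewrite valB valZ opprB bformC.
Qed.

Lemma kconj_refl2 u v w : q u != 0 -> q v != 0 ->
  kconj (vsval u) (kconj (vsval v) (vsval w)) =
  vsval ((refl b eps u \o refl b eps v)%VF w).
Proof.
move=> nzu nzv; rewrite kconj_refl // -valN kconj_refl // -valN comp_lfunE.
by rewrite (linearN (refl b eps u)) opprK.
Qed.

Lemma unit_vectorP P : unit_vector (A' := A') (A := A) P <->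
  exists2 u : W, P = vsval u & unit_norm b eps u.
Proof.
split=> [[VP qP]|[u -> uu]].
  by exists (vsproj V4 P); rewrite ?/unit_norm -?/q -?qform_std vsprojK.
by split; [exact: subvsP|rewrite qform_std].
Qed.

(** The map on the right satisfies the defining equation of [acts_by] for every
factorization of the Clifford element by [kconj_pair_eq]. *)
Lemma acts_by_refl u v f : unit_norm b eps u -> unit_norm b eps v ->
  acts_by (lmul (vsval u) \o lmul (vsval v))%VF f <->
  f = (refl b eps u \o refl b eps v)%VF.
Proof.
move=> uu uv; have nzu := unit_norm_neq0 uu; have nzv := unit_norm_neq0 uv.
split=> [act|-> P1 P2].
  apply/lfunP=> w; apply: val_inj; rewrite /= -kconj_refl2 //.
  by apply: act => //; apply/unit_vectorP; [exists u|exists v].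
case/unit_vectorP=> u' -> uu' /unit_vectorP[v' -> uv'] E w.
have nzu' := unit_norm_neq0 uu'; have nzv' := unit_norm_neq0 uv'.
rewrite -kconj_refl2 //; apply: (kconj_pair_eq cA' cA _ _ E (subvsP w)).
  by split; exact: subvsP.
by rewrite !qform_std; split.
Qed.

Lemma second_order_rotation g :
  (exists2 c, second_order (A' := A') (A := A) c & acts_by c g) <-> rotation b eps g.
Proof.
split=> [[c /second_orderP[P1 [P2 [/unit_vectorP[u -> uu] /unit_vectorP[v -> uv] ->]]]]|].
  by move/(acts_by_refl _ uu uv) => ->; exists u, v.
case=> u [v [uu uv E]]; exists (lmul (vsval u) \o lmul (vsval v))%VF.
  by apply/second_orderP; exists (vsval u), (vsval v); split=> //; apply/unit_vectorP;
    [exists u|exists v].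
exact/acts_by_refl.
Qed.

Lemma second_order_action c : second_order (A' := A') (A := A) c -> exists! f, acts_by c f.
Proof.
case/second_orderP=> P1 [P2 [/unit_vectorP[u -> uu] /unit_vectorP[v -> uv] ->]].
exists (refl b eps u \o refl b eps v)%VF; split; first exact/acts_by_refl.
by move=> f /acts_by_refl ->.
Qed.

Lemma second_order_generate_SO (f : 'End(W)) :
  generated (fun g => exists2 c, second_order c & acts_by c g) f <-> SO_V4 f.
Proof.
have qE := qform_std.
split=> [gen|so].
  apply: (SO_of_ext (fsym qE)); apply/(SO_generated_rotations bb eps_unit).
  by apply: generated_mono gen => g /second_order_rotation.
have /(SO_generated_rotations bb eps_unit) := SO_of_ext qE so.
by apply: generated_mono => g /second_order_rotation.
Qed.

(** The sizes are parameters because the dimensions of the two algebras equal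
kappa and its split analogues only propositionally in k and k'. *)
Lemma SO_V4_iso r N : (m + p')%N = r -> (m + m')%N = N ->
  exists b : N.-tuple W, basis_of fullv b /\
    group_iso (fun f g => f \o g)%VF (fun M N => M *m N) (@SO_V4 R A' A)
      (fun M : 'M_N => let eta := gram (signature_sign R r (n := N)) in
        M^T *m eta *m M = eta /\ \det M = 1) (mx_of_end b).
Proof.
move=> <- <-; exists b; split=> //; have qE := qform_std.
have [hom mor inj surj] := SO_group_iso eps bb.
split=> [f so|f g _ _|f g _ _|M /surj[f so fM]].
- exact: hom (SO_of_ext qE so).
- exact: mx_of_end_comp.
- exact: mx_of_end_inj.
- by exists f => //; apply: (SO_of_ext (fsym qE)).
Qed.

End VectorRepresentation.

Theorem theorem2 (R : realType) (k' k : hurwitz) :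
  let A' := split_algebra R k' in
  let A := division_algebra R k in
  let p := (kappa k + kappa_pos k')%N in
  let q := kappa_neg k' in
  [/\ forall c, second_order (A' := A') (A := A) c ->
        exists! f, acts_by c f,
      forall f : 'End(subvs_of (V4 A' A)),
        generated (fun g => exists2 c, second_order c & acts_by c g) f
        <-> SO_V4 f &
      exists b : (p + q).-tuple (subvs_of (V4 A' A)),
        basis_of fullv b /\
        group_iso (fun f g => f \o g)%VF (fun M N => M *m N)
          (@SO_V4 R A' A) (@SO_pq R p q) (mx_of_end b)].
Proof.
move=> A' A p q.
have cA' := split_composition R k'; have cA := division_composition R k.
split; [exact: (second_order_action cA' cA)|exact: (second_order_generate_SO cA' cA)|].
have dim_pq : ((idim A).+1 + (idim A').+1 = p + q)%N.
  by rewrite division_dim split_dim addnA.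
have pos_p : ((idim A).+1 + kappa_pos k' = p)%N by rewrite division_dim.
have [b [bb iso]] := SO_V4_iso cA' cA pos_p dim_pq.
by exists b; split=> //; move: iso; rewrite gram_signature.
Qed.
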